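(* Let $a\in\mathbb{R}$ be a constant. There exists $\gamma>0$ such that for all $t\le t_\epsilon=\frac{\gamma}{\epsilon^{2}}$, the solution $\tilde u=\epsilon u$ of $$\ddot{\tilde u}+\omega^2\tilde u+c\tilde u^2+\frac{d}{\epsilon}\tilde u^3=0$$ with initial data $$\tilde u(0)=\epsilon a+\epsilon^2\left(-\frac{c a^2}{3\omega^2}+\frac{d a^3}{32\omega^2}\right)+O(\epsilon^3),\qquad \dot u(0)=O(\epsilon^2)$$ has the expansion $$\tilde u(t)=\epsilon a\cos(\nu_\epsilon t)+\epsilon^2\left(-\frac{c a^2}{2\omega^2}+\frac{c a^2}{6\omega^2}\cos(2\nu_\epsilon t)+\frac{d a^3}{32\omega^2}\cos(3\nu_\epsilon t)\right)+\epsilon^3 r(\epsilon,t)$$ with $$\nu_\epsilon=\omega+\epsilon\frac{3da^2}{8\omega}+\epsilon^2\left(-\frac{5c^2a^2}{12\omega^3}-\frac{15d^2a^4}{256\omega^3}\right)+O(\epsilon^3)$$ and $r$ uniformly bounded (with respect to $\epsilon$) in $C^2(0,t_\epsilon)$.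
   Context: $\omega>0$ and $c,d$ are real constants, and $\epsilon>0$ is a small parameter (statements hold for $\epsilon$ small enough). The function $u$ is defined by $\tilde u=\epsilon u$, so that $\ddot u+\omega^2u+\epsilon cu^2+\epsilon du^3=0$. The symbol $O(\epsilon^k)$ refers to the limit $\epsilon\to0$. ''Uniformly bounded in $C^2(0,t_\epsilon)$'' means that $r(\epsilon,\cdot)$ and its first two time derivatives are bounded on $(0,t_\epsilon)$ by a constant independent of $\epsilon$. *)

(* Defs.v *)
From Stdlib Require Import Reals.
From Coquelicot Require Import Coquelicot.
Open Scope R_scope.

(** [f(eps) = O(g(eps))] as [eps] tends to [0] through positive values. *)
Definition bigO_0 (f g : R -> R) : Prop :=
  exists K : R, at_right 0 (fun eps => Rabs (f eps) <= K * Rabs (g eps)).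

(** Same as [is_derive], with the filter restricted to [[0, T]]: the derivative
    is one-sided at the two endpoints. *)
Definition is_derive_on (T : R) (f : R -> R) (t l : R) : Prop :=
  filterdiff (K := R_AbsRing) (U := R_NormedModule) (V := R_NormedModule)
    f (within (fun s => 0 <= s <= T) (locally t)) (fun y => scal y l).

(** [x] solves [x'' + omega^2 x + c x^2 + (d / eps) x^3 = 0] on [[0, T]] with
    [x(0) = x0] and [x'(0) = y0]; the witness [y] is the velocity [x']. *)
Definition solves_ivp (omega c d eps T x0 y0 : R) (x : R -> R) : Prop :=
  exists y : R -> R,
    x 0 = x0 /\ y 0 = y0 /\
    forall t, 0 <= t <= T ->
      is_derive_on T x t (y t) /\
      exists z : R,
        is_derive_on T y t z /\
        z + omega ^ 2 * x t + c * x t ^ 2 + d / eps * x t ^ 3 = 0.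

Definition C2_bounded (M T : R) (r : R -> R) : Prop :=
  forall k : nat, (k <= 2)%nat -> forall t, 0 < t < T ->
    ex_derive_n r k t /\
    continuous (Derive_n r k) t /\
    Rabs (Derive_n r k t) <= M.

(* Main.v *)
(** Write [x = eps u], so that [u'' + omega^2 u + p u^2 + q u^3 = 0] with
    [p = eps c] and [q = eps d].  A Gronwall estimate loses a factor
    [exp (K / eps)] over times of order [1 / eps^2]; instead the orbits, which are
    closed because the energy is conserved, are solved exactly.  If [m + A] and
    [m - A] are the turning points, the quartic energy factors through
    [A^2 - (u - m)^2], and [u = m + A cos phi] reduces the equation to
    [phi' = sqrt (speed2 (A cos phi))] with an explicit polynomial [speed2].  The time
    [T(phi)], a primitive of [1 / sqrt speed2], satisfies
    [T (phi + 2 PI) = T phi + 2 PI / nu].  Hence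
    [nu T(phi) - phi] is periodic in [phi], and an expansion of it over one period
    holds for all times, with no secular error.  Inverting
    [nu T(phi) = nu t + const] to first order in [eps] gives the expansion of [u];
    that of [u''] follows from the equation, and the remainder's first derivative is
    bounded by interpolation. *)

Require Import Defs.
From Stdlib Require Import Reals Lra Lia ClassicalEpsilon.
From Coquelicot Require Import Coquelicot.
Open Scope R_scope.

(** * Trigonometric estimates *)

(** Estimates are made on [u], so each order is one power of [eps] lower than in the statement. The
    expansion refers to the exact frequency [nu] of each orbit; how [nu] depends on [eps] is a
    separate computation, from the mean of [1 / sqrt speed2] over a period. It needs the amplitude
    only up to [O(eps^2)], because [A] enters the frequency with a factor [eps]. Orbits are
    parametrized by centre and amplitude rather than by energy: the turning points are then explicit
    and [speed2] is a polynomial in [m], [A] and the position. The delicate case is [a = 0], where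
    an orbit may shrink to a point and its phase loses meaning; smallness of the initial phase is
    therefore only claimed after multiplication by [A]. The conditions [|p| L <= omega^2 / 16] and
    [|q| L^2 <= omega^2 / 16], with [L] independent of [eps], make the nonlinearity a perturbation
    on the whole orbit: they yield the turning points, the centre and a positive lower bound on the
    speed. *)

Lemma is_derive_bound (f df : R -> R) (K : R) :
  (forall x, is_derive f x (df x)) -> (forall x, Rabs (df x) <= K) ->
  forall x y, Rabs (f y - f x) <= K * Rabs (y - x).
Proof.
intros Hf HK x y.
apply (bounded_variation f df); intros t _; split; [apply Hf | apply HK].
Qed.

Lemma Rabs_sin_le_1 (x : R) : Rabs (sin x) <= 1.
Proof. apply Rabs_le; pose proof (SIN_bound x); lra. Qed.

Lemma Rabs_cos_le_1 (x : R) : Rabs (cos x) <= 1.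
Proof. apply Rabs_le; pose proof (COS_bound x); lra. Qed.

Lemma sin_lipschitz (x y : R) : Rabs (sin y - sin x) <= Rabs (y - x).
Proof.
rewrite <- (Rmult_1_l (Rabs (y - x))).
apply (is_derive_bound sin cos); [intros z; apply is_derive_sin | apply Rabs_cos_le_1].
Qed.

Lemma cos_lipschitz (x y : R) : Rabs (cos y - cos x) <= Rabs (y - x).
Proof.
rewrite <- (Rmult_1_l (Rabs (y - x))).
apply (is_derive_bound cos (fun z => - sin z)).
- intros z; apply is_derive_cos.
- intros z; rewrite Rabs_Ropp; apply Rabs_sin_le_1.
Qed.

Lemma cos_taylor1 (b h : R) : Rabs (cos (b + h) - cos b + h * sin b) <= h ^ 2.
Proof.
set (g := fun s => cos (b + s) - cos b + s * sin b).
assert (H0 : g 0 = 0) by (unfold g; rewrite Rplus_0_r; ring).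
replace (cos (b + h) - cos b + h * sin b) with (g h - g 0) by (rewrite H0; unfold g; ring).
replace (h ^ 2) with (Rabs h * Rabs (h - 0))
  by (rewrite Rminus_0_r, <- Rabs_mult, Rabs_pos_eq; [ring | nra]).
apply (bounded_variation g (fun s => - sin (b + s) + sin b)).
intros t Ht; rewrite !Rminus_0_r in Ht; split.
- unfold g; auto_derive; [trivial | ring].
- rewrite Rplus_comm; apply Rle_trans with (2 := Ht).
  replace (sin b + - sin (b + t)) with (- (sin (b + t) - sin b)) by ring.
  rewrite Rabs_Ropp; eapply Rle_trans; [apply sin_lipschitz|].
  right; f_equal; ring.
Qed.

Lemma polar_angle (x y : R) : x ^ 2 + y ^ 2 = 1 ->
  exists th, Rabs th <= PI /\ cos th = x /\ sin th = y.
Proof.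
intros H.
assert (Hx : -1 <= x <= 1) by nra.
pose proof (acos_bound x) as Hb.
assert (Hs : sin (acos x) = Rabs y).
{ rewrite sin_acos by assumption.
  replace (1 - Rsqr x) with (Rsqr y) by (unfold Rsqr; lra).
  apply sqrt_Rsqr_abs. }
destruct (Rle_dec 0 y) as [Hy | Hy].
- exists (acos x); repeat split.
  + rewrite Rabs_pos_eq; lra.
  + apply cos_acos; assumption.
  + rewrite Hs; apply Rabs_pos_eq; assumption.
- exists (- acos x); repeat split.
  + rewrite Rabs_Ropp, Rabs_pos_eq; lra.
  + rewrite cos_neg; apply cos_acos; assumption.
  + rewrite sin_neg, Hs, Rabs_left; lra.
Qed.

(** Turns a bound on [A sin phi0], which the initial velocity gives, into one on [A phi0]. The
    condition on the cosine keeps away from the zeros of [sin] at [PI] and [- PI]. With [y = z / 2]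
    it gives [cos y >= 1/2], and [sin y >= y - y^3 / 6 >= y / 3] because [y <= 2]. *)
Lemma Rabs_le_sin (x : R) :
  Rabs x <= PI -> - / 2 <= cos x -> Rabs x <= 6 * Rabs (sin x).
Proof.
assert (Hpos : forall z, 0 <= z <= PI -> - / 2 <= cos z -> z <= 6 * sin z).
{ intros z Hz Hc.
  pose proof PI_4 as HPI.
  set (y := z / 2).
  assert (Ey : z = 2 * y) by (unfold y; field).
  rewrite Ey in Hc |- *; rewrite sin_2a, cos_2a_cos in *.
  destruct (pre_sin_bound y 0) as [Hs _]; [lra | lra |].
  unfold sin_approx, sin_term in Hs; simpl in Hs.
  assert (Hcy : 0 <= cos y) by (apply cos_ge_0; lra).
  assert (/ 2 <= cos y) by nra.
  assert (y / 3 <= sin y).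
  { eapply Rle_trans; [|exact Hs].
    assert (0 <= y * (4 - y * y)) by (apply Rmult_le_pos; nra).
    lra. }
  assert (0 <= (cos y - / 2) * sin y) by (apply Rmult_le_pos; lra).
  lra. }
intros Hx Hc.
destruct (Rle_dec 0 x) as [H | H].
- rewrite Rabs_pos_eq in Hx |- * by assumption.
  rewrite (Rabs_pos_eq (sin x)) by (apply sin_ge_0; lra).
  apply Hpos; [lra | assumption].
- rewrite Rabs_left in Hx |- * by lra.
  rewrite <- Rabs_Ropp, <- sin_neg.
  rewrite (Rabs_pos_eq (sin (- x))) by (apply sin_ge_0; lra).
  apply Hpos; [lra | rewrite cos_neg; assumption].
Qed.

(** * Exact orbits *)

Definition potential (o p q u : R) : R := o * u ^ 2 / 2 + p * u ^ 3 / 3 + q * u ^ 4 / 4.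

(* [speed2 o p q m A (A cos phi)] is the square of [phi'] along the orbit
   [u = m + A cos phi]. *)
Definition speed2 (o p q m A s : R) : R :=
  o + 2 * p * m + 3 * q * m ^ 2 + (2 * p / 3 + 2 * q * m) * s
  + q / 2 * (A ^ 2 + s ^ 2).

(* The odd part of [s |-> potential (m + s)] vanishes at [s = A]: the turning
   points [m + A] and [m - A] have the same energy. *)
Definition balanced (o p q m A : R) : Prop :=
  o * m + p * m ^ 2 + q * m ^ 3 + (p / 3 + q * m) * A ^ 2 = 0.

(** The harmonic part alone gains [o / 2 * (y^2 - x^2)]; below [L] the cubic and quartic parts cost
    at most half of it. Dividing the positions by [L] brings them into the unit interval, where
    their higher powers are bounded by lower ones. *)
Lemma potential_increase (o p q L x y : R) :
  0 < o -> Rabs p * L <= o / 16 -> Rabs q * L ^ 2 <= o / 16 ->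
  0 <= x <= y -> y <= L ->
  o / 4 * (y ^ 2 - x ^ 2) <= potential o p q y - potential o p q x.
Proof.
intros Ho Hp Hq Hxy HyL.
assert (HpL : Rabs (p * L) <= o / 16)
  by (rewrite Rabs_mult, (Rabs_pos_eq L); lra).
assert (HqL : Rabs (q * L ^ 2) <= o / 16)
  by (rewrite Rabs_mult, (Rabs_pos_eq (L ^ 2)); nra).
apply Rabs_le_between in HpL; apply Rabs_le_between in HqL.
destruct (Req_dec L 0) as [HL0 | HL0].
{ assert (x = 0) by lra; assert (y = 0) by lra; subst x y; unfold potential; lra. }
set (z := y / L); set (w := x / L).
assert (Ey : y = L * z) by (unfold z; field; assumption).
assert (Ex : x = L * w) by (unfold w; field; assumption).
assert (Hw : 0 <= w <= z /\ z <= 1) by (rewrite Ex, Ey in *; nra).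
clearbody z w; subst x y; unfold potential.
replace (o * (L * z) ^ 2 / 2 + p * (L * z) ^ 3 / 3 + q * (L * z) ^ 4 / 4 -
  (o * (L * w) ^ 2 / 2 + p * (L * w) ^ 3 / 3 + q * (L * w) ^ 4 / 4)) with
  (L ^ 2 * (z - w) * (o / 2 * (z + w) + p * L * (z ^ 2 + z * w + w ^ 2) / 3
    + q * L ^ 2 * ((z + w) * (z ^ 2 + w ^ 2)) / 4)) by field.
replace (o / 4 * ((L * z) ^ 2 - (L * w) ^ 2)) with
  (L ^ 2 * (z - w) * (o / 4 * (z + w))) by ring.
apply Rmult_le_compat_l; [apply Rmult_le_pos; nra|].
assert (H1 : 0 <= z ^ 2 + z * w + w ^ 2 <= 2 * (z + w)) by nra.
assert (H2 : 0 <= (z + w) * (z ^ 2 + w ^ 2) <= 2 * (z + w)) by nra.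
assert (0 <= (p * L + o / 16) * (z ^ 2 + z * w + w ^ 2))
  by (apply Rmult_le_pos; lra).
assert (0 <= (q * L ^ 2 + o / 16) * ((z + w) * (z ^ 2 + w ^ 2)))
  by (apply Rmult_le_pos; lra).
assert (0 <= o * (2 * (z + w) - (z ^ 2 + z * w + w ^ 2))) by (apply Rmult_le_pos; lra).
assert (0 <= o * (2 * (z + w) - (z + w) * (z ^ 2 + w ^ 2))) by (apply Rmult_le_pos; lra).
assert (0 <= o * (z + w)) by (apply Rmult_le_pos; lra).
lra.
Qed.

Lemma turning_point (w p q L u0 v0 : R) :
  0 < w -> 0 <= u0 -> u0 + 2 * Rabs v0 / w <= L ->
  Rabs p * L <= w ^ 2 / 16 -> Rabs q * L ^ 2 <= w ^ 2 / 16 ->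
  exists up, u0 <= up <= L /\
    potential (w ^ 2) p q up = potential (w ^ 2) p q u0 + v0 ^ 2 / 2 /\
    up ^ 2 - u0 ^ 2 <= 2 * v0 ^ 2 / w ^ 2.
Proof.
intros Hw Hu HL Hp Hq.
assert (Ho : 0 < w ^ 2) by (apply pow_lt; assumption).
(* Over a step [d] the potential gains at least [w^2 d^2 / 4 = v0^2], which exceeds the available
   kinetic energy [v0^2 / 2] unless both vanish. *)
set (d := 2 * Rabs v0 / w) in *.
assert (Hd : w ^ 2 * d ^ 2 = 4 * v0 ^ 2).
{ unfold d; rewrite <- (pow2_abs v0); field; lra. }
assert (Hd0 : 0 <= d).
{ unfold d; apply Rdiv_le_0_compat; [pose proof (Rabs_pos v0); lra | assumption]. }
set (f := fun u => potential (w ^ 2) p q u - potential (w ^ 2) p q u0 - v0 ^ 2 / 2).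
destruct (IVT_cor f u0 (u0 + d)) as [up [Hup Hf]].
- intros x; apply continuity_pt_filterlim.
  apply (ex_derive_continuous f); unfold f, potential; auto_derive; trivial.
- lra.
- assert (Hf0 : f u0 <= 0) by (pose proof (pow2_ge_0 v0); unfold f; lra).
  assert (Hf1 : 0 <= f (u0 + d)).
  { pose proof (potential_increase (w ^ 2) p q L u0 (u0 + d) Ho Hp Hq
      ltac:(lra) ltac:(lra)) as H.
    assert (0 <= w ^ 2 * (u0 * d)) by (apply Rmult_le_pos; nra).
    pose proof (pow2_ge_0 v0); unfold f; nra. }
  nra.
- exists up; split; [lra|].
  split; [unfold f in Hf; lra|].
  pose proof (potential_increase (w ^ 2) p q L u0 up Ho Hp Hq
    ltac:(lra) ltac:(lra)) as H.
  apply Rmult_le_reg_l with (w ^ 2); [assumption|].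
  replace (w ^ 2 * (2 * v0 ^ 2 / w ^ 2)) with (2 * v0 ^ 2) by (field; lra).
  unfold f in Hf; lra.
Qed.

(** With one turning point known, the centre is a zero of a function close to [o * m], found by the
    intermediate value theorem. To leading order it is [- p up^2 / (3 o)]; the bracket is three
    times as large to leave room for the corrections. A bound in [up^2], not [L^2], keeps the centre
    small relative to the amplitude even on tiny orbits. *)
Lemma orbit_centre (o p q L up : R) :
  0 < o -> Rabs up <= L -> Rabs p * L <= o / 16 -> Rabs q * L ^ 2 <= o / 16 ->
  exists m, Rabs m <= Rabs p * up ^ 2 / o /\ balanced o p q m (up - m).
Proof.
intros Ho Hup Hp Hq.
set (k := Rabs p * up ^ 2 / o).
assert (Hk : o * k = Rabs p * up ^ 2) by (unfold k; field; lra).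
assert (Hk0 : 0 <= k).
{ unfold k; apply Rdiv_le_0_compat; [|assumption].
  apply Rmult_le_pos; [apply Rabs_pos | nra]. }
set (f := fun m => o * m + p * m ^ 2 + q * m ^ 3 + (p / 3 + q * m) * (up - m) ^ 2).
assert (Hmain : forall m, Rabs m <= k -> Rabs (f m - o * m) <= o * k).
{ intros m Hm.
  pose proof (Rabs_pos up) as HU0; pose proof (Rabs_pos p) as Hp0.
  pose proof (Rabs_pos q) as Hq0; pose proof (Rabs_pos m) as Hm0.
  assert (HpU : Rabs p * Rabs up <= o / 16)
    by (eapply Rle_trans; [apply Rmult_le_compat_l|]; eassumption).
  assert (HqU : Rabs q * Rabs up ^ 2 <= o / 16).
  { eapply Rle_trans; [apply Rmult_le_compat_l|]; [assumption | | eassumption].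
    apply pow_incr; lra. }
  assert (HkU : k <= Rabs up / 16).
  { apply Rmult_le_reg_l with o; [assumption|].
    rewrite Hk, <- (pow2_abs up).
    assert (0 <= Rabs up * (o / 16 - Rabs p * Rabs up)) by (apply Rmult_le_pos; lra).
    lra. }
  set (s := (up - m) ^ 2).
  assert (Hs : 0 <= s <= (17 / 16 * Rabs up) ^ 2).
  { unfold s; split; [apply pow2_ge_0|].
    rewrite <- (pow2_abs (up - m)).
    apply pow_incr; split; [apply Rabs_pos|].
    pose proof (Rabs_triang up (- m)) as Ht; rewrite Rabs_Ropp in Ht.
    unfold Rminus; lra. }
  assert (Hm2 : m ^ 2 <= (Rabs up / 16) ^ 2)
    by (rewrite <- (pow2_abs m); apply pow_incr; lra).
  assert (H1 : Rabs (p * (m ^ 2 + s / 3)) <= o * k / 2).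
  { rewrite Rabs_mult, (Rabs_pos_eq (m ^ 2 + s / 3)) by (pose proof (pow2_ge_0 m); lra).
    rewrite Hk, <- (pow2_abs up).
    assert (0 <= Rabs p * (Rabs up ^ 2 / 2 - (m ^ 2 + s / 3)))
      by (apply Rmult_le_pos; nra).
    lra. }
  assert (H2 : Rabs (q * (m * (m ^ 2 + s))) <= o * k / 2).
  { rewrite !Rabs_mult, (Rabs_pos_eq (m ^ 2 + s)) by (pose proof (pow2_ge_0 m); lra).
    apply Rle_trans with (Rabs q * (k * (2 * Rabs up ^ 2))).
    - apply Rmult_le_compat_l; [assumption|].
      apply Rmult_le_compat; [assumption | pose proof (pow2_ge_0 m); lra | assumption | nra].
    - assert (0 <= k * (o / 16 - Rabs q * Rabs up ^ 2)) by (apply Rmult_le_pos; lra).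
      nra. }
  replace (f m - o * m) with (p * (m ^ 2 + s / 3) + q * (m * (m ^ 2 + s)))
    by (unfold f, s; field).
  eapply Rle_trans; [apply Rabs_triang | lra]. }
destruct (IVT_cor f (- k) k) as [m [Hm Hf]].
- intros x; apply continuity_pt_filterlim.
  apply (ex_derive_continuous f); unfold f; auto_derive; trivial.
- lra.
- pose proof (Hmain (- k)) as H1; pose proof (Hmain k) as H2.
  rewrite Rabs_Ropp in H1; rewrite (Rabs_pos_eq k) in H1, H2 by assumption.
  specialize (H1 (Rle_refl _)); specialize (H2 (Rle_refl _)).
  apply Rabs_le_between in H1; apply Rabs_le_between in H2.
  assert (f (- k) <= 0) by lra; assert (0 <= f k) by lra; nra.
- exists m; split; [apply Rabs_le; assumption | exact Hf].
Qed.

(** Keeps [sqrt speed2] away from zero along the orbit. The factor 17/16 is 1 + 1/16: positions are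
    at most [L], and they are measured from a centre within [L / 16] of the origin. *)
Lemma speed2_bound (o p q L m A s : R) :
  0 < o -> Rabs p * L <= o / 16 -> Rabs q * L ^ 2 <= o / 16 ->
  Rabs m <= / 16 * L -> Rabs A <= 17 / 16 * L -> Rabs s <= 17 / 16 * L ->
  Rabs (speed2 o p q m A s - o) <= o / 2.
Proof.
intros Ho Hp Hq Hm HA Hs.
assert (Hp' : forall x k, 0 <= k -> Rabs x <= k * L -> Rabs (p * x) <= k * (o / 16)).
{ intros x k Hk Hx; rewrite Rabs_mult.
  assert (Rabs p * Rabs x <= Rabs p * (k * L))
    by (apply Rmult_le_compat_l; [apply Rabs_pos | assumption]).
  assert (k * (Rabs p * L) <= k * (o / 16)) by (apply Rmult_le_compat_l; assumption).
  lra. }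
assert (Hq' : forall x y j k, 0 <= j -> 0 <= k -> Rabs x <= j * L -> Rabs y <= k * L ->
  Rabs (q * (x * y)) <= j * k * (o / 16)).
{ intros x y j k Hj Hk Hx Hy; rewrite !Rabs_mult.
  assert (Rabs q * (Rabs x * Rabs y) <= Rabs q * ((j * L) * (k * L))).
  { apply Rmult_le_compat_l; [apply Rabs_pos|].
    apply Rmult_le_compat; auto using Rabs_pos. }
  assert (j * k * (Rabs q * L ^ 2) <= j * k * (o / 16))
    by (apply Rmult_le_compat_l; [apply Rmult_le_pos|]; assumption).
  lra. }
pose proof (Hp' m (/ 16) ltac:(lra) Hm) as B1.
pose proof (Hp' s (17 / 16) ltac:(lra) Hs) as B2.
pose proof (Hq' m m (/ 16) (/ 16) ltac:(lra) ltac:(lra) Hm Hm) as B3.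
pose proof (Hq' m s (/ 16) (17 / 16) ltac:(lra) ltac:(lra) Hm Hs) as B4.
pose proof (Hq' A A (17 / 16) (17 / 16) ltac:(lra) ltac:(lra) HA HA) as B5.
pose proof (Hq' s s (17 / 16) (17 / 16) ltac:(lra) ltac:(lra) Hs Hs) as B6.
apply Rabs_le_between in B1; apply Rabs_le_between in B2; apply Rabs_le_between in B3.
apply Rabs_le_between in B4; apply Rabs_le_between in B5; apply Rabs_le_between in B6.
unfold speed2; apply Rabs_le; lra.
Qed.

Lemma balanced_energy (o p q m A s : R) : balanced o p q m A ->
  potential o p q (m + A) - potential o p q (m + s)
  = (A ^ 2 - s ^ 2) * speed2 o p q m A s / 2.
Proof.
unfold balanced, potential, speed2; intros H.
(* Without the balance the identity has an extra term: [A - s] times the left side of [balanced]. *)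
transitivity ((A ^ 2 - s ^ 2) * (o + 2 * p * m + 3 * q * m ^ 2
  + (2 * p / 3 + 2 * q * m) * s + q / 2 * (A ^ 2 + s ^ 2)) / 2
  + (A - s) * (o * m + p * m ^ 2 + q * m ^ 3 + (p / 3 + q * m) * A ^ 2)).
- field.
- rewrite H; ring.
Qed.

(** Minus the derivative of [balanced_energy] in [s]: the force is the derivative of the potential,
    and the last factor is that of [speed2]. *)
Lemma balanced_force (o p q m A s : R) : balanced o p q m A ->
  o * (m + s) + p * (m + s) ^ 2 + q * (m + s) ^ 3
  = s * speed2 o p q m A s - (A ^ 2 - s ^ 2) / 2 * (2 * p / 3 + 2 * q * m + q * s).
Proof.
unfold balanced, speed2; intros H.
transitivity (s * (o + 2 * p * m + 3 * q * m ^ 2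
  + (2 * p / 3 + 2 * q * m) * s + q / 2 * (A ^ 2 + s ^ 2))
  - (A ^ 2 - s ^ 2) / 2 * (2 * p / 3 + 2 * q * m + q * s)
  + (o * m + p * m ^ 2 + q * m ^ 3 + (p / 3 + q * m) * A ^ 2)).
- field.
- rewrite H; ring.
Qed.

(* Centre, signed amplitude and initial phase of the orbit through [(u0, v0)].  The
   phase alone is not controlled by [v0] on small orbits (the case [a = 0]), only its
   product with the amplitude, which is all that the expansion of [A cos phi] needs. *)
Definition orbit_data (w p q L u0 v0 m A phi0 : R) : Prop :=
  balanced (w ^ 2) p q m A /\
  Rabs m <= Rabs p * L ^ 2 / w ^ 2 /\ Rabs A <= 2 * L /\
  Rabs (m + A - u0) <= 2 * Rabs v0 / w /\
  (forall C, Rabs C <= 1 -> Rabs (speed2 (w ^ 2) p q m A (A * C) - w ^ 2) <= w ^ 2 / 2) /\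
  u0 = m + A * cos phi0 /\
  v0 = - A * sin phi0 * sqrt (speed2 (w ^ 2) p q m A (A * cos phi0)) /\
  Rabs phi0 <= PI /\ Rabs (A * phi0) <= 12 * Rabs v0 / w.

(** For [u0 >= 0] the orbit is anchored at its right turning point, so that the starting point is
    never near the left one and the phase is controlled by the velocity. *)
Lemma orbit_data_pos (w p q L u0 v0 : R) :
  0 < w -> 0 <= u0 -> u0 + 2 * Rabs v0 / w <= L ->
  Rabs p * L <= w ^ 2 / 16 -> Rabs q * L ^ 2 <= w ^ 2 / 16 ->
  exists m A phi0, orbit_data w p q L u0 v0 m A phi0.
Proof.
intros Hw Hu HL Hp Hq.
assert (Ho : 0 < w ^ 2) by (apply pow_lt; assumption).
destruct (turning_point w p q L u0 v0 Hw Hu HL Hp Hq) as [up [Hup [HE Hd]]].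
assert (HupL : Rabs up <= L) by (rewrite Rabs_pos_eq; lra).
destruct (orbit_centre (w ^ 2) p q L up Ho HupL Hp Hq) as [m [Hm Hbal]].
pose proof (Rabs_pos p) as Hp0; pose proof (Rabs_pos m) as Hm0.
pose proof (Rabs_pos v0) as Hv0.
assert (Hmup : Rabs m <= / 16 * up).
{ apply Rle_trans with (1 := Hm); apply Rle_div_l; [assumption|].
  assert (0 <= up * (Rabs p * (L - up))) by (repeat apply Rmult_le_pos; lra).
  assert (0 <= up * (w ^ 2 / 16 - Rabs p * L)) by (apply Rmult_le_pos; lra).
  nra. }
set (A := up - m) in *.
assert (HA : 15 / 16 * up <= A <= 17 / 16 * up)
  by (apply Rabs_le_between in Hmup; unfold A; lra).
assert (HS : forall s, Rabs s <= 17 / 16 * L ->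
  Rabs (speed2 (w ^ 2) p q m A s - w ^ 2) <= w ^ 2 / 2).
{ intros s Hs; apply speed2_bound with L; try assumption; [lra|].
  rewrite Rabs_pos_eq; lra. }
assert (HSC : forall C, Rabs C <= 1 ->
  Rabs (speed2 (w ^ 2) p q m A (A * C) - w ^ 2) <= w ^ 2 / 2).
{ intros C HC; apply HS; rewrite Rabs_mult, (Rabs_pos_eq A) by lra.
  pose proof (Rabs_pos C); nra. }
(* From [0 <= u0 <= up], [(up - u0)^2 <= up^2 - u0^2], which the turning point bounds. The resulting
   bound is linear in [v0] and does not degenerate when [u0] is small. *)
assert (Hdist : Rabs (m + A - u0) <= 2 * Rabs v0 / w).
{ replace (m + A - u0) with (up - u0) by (unfold A; ring).
  rewrite Rabs_pos_eq by lra.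
  apply Rsqr_incr_0_var; [|apply Rdiv_le_0_compat; lra].
  unfold Rsqr; replace (2 * Rabs v0 / w * (2 * Rabs v0 / w)) with
    (2 * (2 * Rabs v0 ^ 2 / w ^ 2)) by (field; lra).
  rewrite pow2_abs.
  assert (0 <= up ^ 2 - u0 ^ 2) by nra.
  nra. }
assert (Hphi : exists phi0, u0 = m + A * cos phi0 /\
  v0 = - A * sin phi0 * sqrt (speed2 (w ^ 2) p q m A (A * cos phi0)) /\
  Rabs phi0 <= PI /\ Rabs (A * phi0) <= 12 * Rabs v0 / w).
{ set (s := u0 - m).
  set (S := speed2 (w ^ 2) p q m A s).
  assert (Hs : Rabs s <= 17 / 16 * L).
  { unfold s, Rminus; eapply Rle_trans; [apply Rabs_triang|].
    rewrite Rabs_Ropp, (Rabs_pos_eq u0) by assumption; lra. }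
  specialize (HS s Hs); fold S in HS; apply Rabs_le_between in HS.
  assert (HAs : (A ^ 2 - s ^ 2) * S = v0 ^ 2).
  { pose proof (balanced_energy _ _ _ _ _ s Hbal) as H; fold S in H.
    replace (m + A) with up in H by (unfold A; ring).
    replace (m + s) with u0 in H by (unfold s; ring).
    lra. }
  (* If [up = 0] the orbit is the equilibrium and any phase would do; otherwise the energy identity
     puts the point [(s / A, - v0 / (A sqrt S))] on the unit circle. *)
  destruct (Req_dec up 0) as [Hup0 | Hup0].
  - assert (m = 0) by (apply Rabs_eq_0; lra).
    assert (A = 0) by lra.
    assert (u0 = 0) by lra.
    assert (v0 = 0).
    { assert (s = 0) by (unfold s; lra).
      apply Rsqr_0_uniq; rewrite Rsqr_pow2, <- HAs.
      replace A with 0; replace s with 0; ring. }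
    exists 0; subst u0 v0; replace m with 0; replace A with 0.
    rewrite !Rabs_R0, !Rmult_0_l, Rabs_R0.
    pose proof PI_RGT_0; repeat split; lra.
  - assert (HA0 : 0 < A) by lra.
    pose proof (sqrt_lt_R0 S ltac:(lra)) as HsS.
    pose proof (sqrt_sqrt S ltac:(lra)) as HsS2.
    destruct (polar_angle (s / A) (- v0 / (A * sqrt S))) as [phi0 [H1 [H2 H3]]].
    { transitivity (s ^ 2 / A ^ 2 + v0 ^ 2 / (A ^ 2 * (sqrt S * sqrt S))).
      - field; lra.
      - rewrite HsS2, <- HAs; field; lra. }
    assert (Hs' : A * cos phi0 = s) by (rewrite H2; field; lra).
    assert (Hv' : v0 = - A * sin phi0 * sqrt S) by (rewrite H3; field; lra).
    exists phi0; rewrite Hs'; fold S; repeat split; try assumption.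
    + unfold s; ring.
    (* Since [u0 >= 0], [s >= - m >= - up / 16], while [A >= 15/16 up]. The constant 12 is then the
       6 of [Rabs_le_sin] divided by the lower bound [w / 2] of the speed. *)
    + assert (Hc : - / 2 <= cos phi0).
      { rewrite H2; apply Rle_div_r; [assumption|].
        unfold s; apply Rabs_le_between in Hmup; lra. }
      pose proof (Rabs_le_sin phi0 H1 Hc) as Hsin.
      assert (HwS : w / 2 <= sqrt S).
      { rewrite <- (sqrt_pow2 (w / 2)) by lra; apply sqrt_le_1; nra. }
      rewrite Rabs_mult, (Rabs_pos_eq A) by lra.
      apply Rle_trans with (A * (6 * Rabs (sin phi0))).
      { apply Rmult_le_compat_l; lra. }
      apply Rmult_le_reg_r with w; [assumption|].
      unfold Rdiv; rewrite (Rmult_assoc _ (/ w)), Rinv_l, Rmult_1_r by lra.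
      rewrite Hv', !Rabs_mult, Rabs_Ropp, (Rabs_pos_eq A), (Rabs_pos_eq (sqrt S)) by lra.
      assert (0 <= A * Rabs (sin phi0) * (sqrt S - w / 2)).
      { repeat apply Rmult_le_pos; [lra | apply Rabs_pos | lra]. }
      lra. }
destruct Hphi as [phi0 [H1 [H2 [H3 H4]]]].
exists m, A, phi0; repeat split; try assumption.
- apply Rle_trans with (1 := Hm).
  apply Rmult_le_compat_r; [left; apply Rinv_0_lt_compat; assumption|].
  apply Rmult_le_compat_l; [assumption | apply pow_incr; lra].
- rewrite Rabs_pos_eq; lra.
Qed.

(** The reflection [u -> - u] preserves the equation up to the sign of [p]. It reduces [u0 < 0] to
    [u0 >= 0] with the same phase, at the price of a negative amplitude. *)
Lemma speed2_opp (o p q m A s : R) :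
  speed2 o (- p) q (- m) (- A) (- s) = speed2 o p q m A s.
Proof. unfold speed2; field. Qed.

Lemma orbit_data_exists (w p q L u0 v0 : R) :
  0 < w -> Rabs u0 + 2 * Rabs v0 / w <= L ->
  Rabs p * L <= w ^ 2 / 16 -> Rabs q * L ^ 2 <= w ^ 2 / 16 ->
  exists m A phi0, orbit_data w p q L u0 v0 m A phi0.
Proof.
intros Hw HL Hp Hq.
destruct (Rle_dec 0 u0) as [Hu | Hu].
- rewrite Rabs_pos_eq in HL by assumption.
  apply orbit_data_pos; assumption.
- rewrite Rabs_left in HL by lra.
  destruct (orbit_data_pos w (- p) q L (- u0) (- v0)) as [m [A [phi0 H]]];
    rewrite ?Rabs_Ropp; try assumption; try lra.
  exists (- m), (- A), phi0.
  destruct H as [H1 [H2 [H3 [H4 [H5 [H6 [H7 [H8 H9]]]]]]]].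
  rewrite ?Rabs_Ropp in *.
  assert (HS : forall s, speed2 (w ^ 2) p q (- m) (- A) (- A * s)
    = speed2 (w ^ 2) (- p) q m A (A * s)).
  { intros s; rewrite <- speed2_opp, !Ropp_involutive; f_equal; ring. }
  repeat split; rewrite ?Rabs_Ropp; try assumption.
  + unfold balanced in *; lra.
  + replace (- m + - A - u0) with (- (m + A - - u0)) by ring.
    rewrite Rabs_Ropp; assumption.
  + intros C HC; rewrite HS; auto.
  + lra.
  + rewrite HS; lra.
  + rewrite Ropp_mult_distr_l_reverse, Rabs_Ropp; assumption.
Qed.

(** * Primitives and inverse functions *)

Lemma is_derive_continuity_pt (f : R -> R) (x l : R) : is_derive f x l -> continuity_pt f x.
Proof.
intros H; apply continuity_pt_filterlim.
apply (ex_derive_continuous f); exists l; exact H.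
Qed.

Lemma is_derive_increase (f df : R -> R) (k x y : R) :
  (forall z, is_derive f z (df z)) -> (forall z, k <= df z) -> x <= y ->
  k * (y - x) <= f y - f x.
Proof.
intros Hf Hk Hxy.
destruct (MVT_gen f x y df) as [c [_ Hc]].
- intros z _; apply Hf.
- intros z _; apply is_derive_continuity_pt with (df z), Hf.
- rewrite Hc; apply Rmult_le_compat_r; [lra | apply Hk].
Qed.

Lemma primitive_exists (k : R -> R) : (forall x, continuous k x) ->
  exists T : R -> R, T 0 = 0 /\ forall x, is_derive T x (k x).
Proof.
intros Hk; exists (RInt k 0); split.
- apply (RInt_point 0 k).
- intros x; apply (is_derive_RInt k (RInt k 0) 0 x); [|apply Hk].
  apply filter_forall; intros y; apply (RInt_correct k 0 y).
  apply ex_RInt_continuous; intros z _; apply Hk.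
Qed.

Lemma primitive_shift (T k : R -> R) (per : R) :
  (forall x, is_derive T x (k x)) -> (forall x, k (x + per) = k x) -> T 0 = 0 ->
  forall x, T (x + per) = T x + T per.
Proof.
intros HT Hper H0 x.
pose proof (is_derive_bound (fun y => T (y + per) - T y) (fun _ => 0) 0) as H.
assert (Hx : Rabs (T (x + per) - T x - (T (0 + per) - T 0)) <= 0 * Rabs (x - 0)).
{ apply H.
  - intros y; replace 0 with (1 * k (y + per) - k y) by (rewrite Hper; ring).
    apply (is_derive_minus (fun y => T (y + per)) T); [|apply HT].
    apply (is_derive_comp T (fun y => y + per)); [apply HT|].
    auto_derive; [trivial | ring].
  - intros; rewrite Rabs_R0; lra. }
rewrite Rmult_0_l, Rplus_0_l in Hx.
pose proof (Rabs_pos (T (x + per) - T x - (T per - T 0))) as Hpos.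
assert (E : Rabs (T (x + per) - T x - (T per - T 0)) = 0) by lra.
apply Rabs_eq_0 in E; lra.
Qed.

(** A slope of at least [k1] makes [T] onto and expanding by [k1], so its inverse is Lipschitz with
    constant [/ k1]. *)
Lemma increasing_inverse (T k : R -> R) (k1 : R) :
  0 < k1 -> (forall x, k1 <= k x) -> (forall x, is_derive T x (k x)) ->
  exists phi : R -> R, (forall t, T (phi t) = t) /\ (forall x, phi (T x) = x) /\
    forall t, is_derive phi t (/ k (phi t)).
Proof.
intros Hk1 Hk HT.
pose proof (fun x y => is_derive_increase T k k1 x y HT Hk) as Hinc.
assert (Hsurj : forall t, {x | T x = t}).
{ intros t; apply constructive_indefinite_description.
  set (b := Rabs (t - T 0) / k1).
  assert (Hb : k1 * b = Rabs (t - T 0)) by (unfold b; field; lra).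
  pose proof (Rabs_pos (t - T 0)).
  assert (0 <= b) by (apply Rdiv_le_0_compat; assumption).
  pose proof (Hinc 0 b ltac:(lra)); pose proof (Hinc (- b) 0 ltac:(lra)).
  pose proof (Rle_abs (t - T 0)); pose proof (Rle_abs (- (t - T 0))) as Hn.
  rewrite Rabs_Ropp in Hn.
  destruct (IVT_cor (fun x => T x - t) (- b) b) as [x [_ Hx]].
  - intros x; apply is_derive_continuity_pt with (k x - 0).
    apply (is_derive_minus T (fun _ => t)); [apply HT | apply (is_derive_const t)].
  - lra.
  - assert (T (- b) - t <= 0) by lra; assert (0 <= T b - t) by lra; nra.
  - exists x; lra. }
assert (Hexp : forall x y, k1 * Rabs (x - y) <= Rabs (T x - T y)).
{ assert (Hle : forall x y, y <= x -> k1 * Rabs (x - y) <= Rabs (T x - T y)).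
  { intros x y Hxy; rewrite Rabs_pos_eq by lra.
    apply Rle_trans with (T x - T y); [apply Hinc; assumption | apply Rle_abs]. }
  intros x y; destruct (Rle_dec y x) as [Hyx | Hyx]; [apply Hle; assumption|].
  rewrite (Rabs_minus_sym x), (Rabs_minus_sym (T x)); apply Hle; lra. }
assert (Hinj : forall x y, T x = T y -> x = y).
{ intros x y Hxy; specialize (Hexp x y).
  rewrite Hxy, Rminus_diag, Rabs_R0 in Hexp.
  pose proof (Rabs_pos (x - y)).
  assert (E : Rabs (x - y) = 0) by nra; apply Rabs_eq_0 in E; lra. }
set (phi := fun t => proj1_sig (Hsurj t)).
assert (Hphi : forall t, T (phi t) = t) by (intros t; exact (proj2_sig (Hsurj t))).
exists phi; split; [exact Hphi | split; [intros x; apply Hinj, Hphi |]].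
intros t; apply is_derive_Reals.
pose proof (proj1 (is_derive_Reals _ _ _) (HT (phi t))) as HTt.
pose proof (Hk (phi t)) as Hkt.
intros eps Heps.
(* Up to sign, [g / h - / k] is [h / g - k] times [g / h] and [/ k], both at most [/ k1] in absolute
   value; hence the factor [k1 ^ 2]. *)
destruct (HTt (eps * k1 ^ 2)) as [d Hd].
{ apply Rmult_lt_0_compat; [assumption | apply pow_lt; assumption]. }
assert (Hkd : 0 < k1 * d) by (apply Rmult_lt_0_compat; [|destruct d]; assumption).
exists (mkposreal _ Hkd); simpl; intros h Hh0 Hh.
set (g := phi (t + h) - phi t).
assert (Hg : k1 * Rabs g <= Rabs h).
{ replace h with (T (phi (t + h)) - T (phi t)) by (rewrite !Hphi; ring).
  apply Hexp. }
assert (HgT : T (phi t + g) - T (phi t) = h)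
  by (unfold g; rewrite Rplus_minus, !Hphi; ring).
assert (Hg0 : g <> 0).
{ intros E; rewrite E, Rplus_0_r in HgT; lra. }
specialize (Hd g Hg0 ltac:(apply Rmult_lt_reg_l with k1; lra)).
rewrite HgT in Hd.
replace (g / h - / k (phi t)) with
  ((g / h) * (- (h / g - k (phi t))) * / k (phi t)) by (field; lra).
rewrite !Rabs_mult, Rabs_Ropp, Rabs_inv, (Rabs_pos_eq (k (phi t))) by lra.
apply Rle_lt_trans with (/ k1 * Rabs (h / g - k (phi t)) * / k1).
- apply Rmult_le_compat.
  + apply Rmult_le_pos; apply Rabs_pos.
  + left; apply Rinv_0_lt_compat; lra.
  + apply Rmult_le_compat_r; [apply Rabs_pos|].
    unfold Rdiv; rewrite Rabs_mult, Rabs_inv.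
    apply Rmult_le_reg_l with k1; [assumption|].
    apply Rmult_le_reg_r with (Rabs h); [apply Rabs_pos_lt; assumption|].
    rewrite Rinv_r, Rmult_1_l by lra.
    replace (k1 * (Rabs g * / Rabs h) * Rabs h) with (k1 * Rabs g); [assumption|].
    field; apply Rabs_no_R0; assumption.
  + apply Rinv_le_contravar; lra.
- apply Rmult_lt_reg_l with (k1 ^ 2); [apply pow_lt; assumption|].
  replace (k1 ^ 2 * (/ k1 * Rabs (h / g - k (phi t)) * / k1))
    with (Rabs (h / g - k (phi t))) by (field; lra).
  lra.
Qed.

Lemma periodic_bound (f : R -> R) (per K : R) :
  0 < per -> (forall x, f (x + per) = f x) ->
  (forall x, 0 <= x <= per -> Rabs (f x) <= K) -> forall x, Rabs (f x) <= K.
Proof.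
intros Hper Hf HK.
assert (Hpos : forall n x, 0 <= x <= INR (S n) * per -> Rabs (f x) <= K).
{ induction n as [|n IHn]; intros x Hx.
  - apply HK; simpl in Hx; lra.
  - destruct (Rle_dec x per) as [Hx1 | Hx1]; [apply HK; lra|].
    replace x with (x - per + per) by ring; rewrite Hf; apply IHn.
    rewrite S_INR in Hx; lra. }
assert (Hpos' : forall x, 0 <= x -> Rabs (f x) <= K).
{ intros x Hx; destruct (nfloor_ex (x / per)) as [n [_ Hn]].
  { apply Rdiv_le_0_compat; assumption. }
  apply (Hpos n); split; [assumption|].
  rewrite S_INR; apply Rlt_le; apply Rlt_div_l; assumption. }
assert (Hneg : forall n x, - (INR n * per) <= x -> Rabs (f x) <= K).
{ induction n as [|n IHn]; intros x Hx.
  - apply Hpos'; simpl in Hx; lra.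
  - rewrite <- Hf; apply IHn; rewrite S_INR in Hx; lra. }
intros x; destruct (nfloor_ex (Rabs x / per)) as [n [_ Hn]].
{ apply Rdiv_le_0_compat; [apply Rabs_pos | assumption]. }
apply (Hneg (S n)); rewrite S_INR.
apply Rlt_div_l in Hn; [|assumption].
pose proof (Rle_abs (- x)) as H; rewrite Rabs_Ropp in H; lra.
Qed.

(** * Uniqueness of solutions *)

Lemma is_derive_on_intro (T : R) (f : R -> R) (t l : R) :
  0 <= t <= T -> is_derive f t l -> is_derive_on T f t l.
Proof.
intros Ht [Hlin Hd]; split; [exact Hlin|].
intros x Hx.
(* [filterdiff] quantifies over all limits [x] of the restricted filter; as [t] lies in the
   interval, no point other than [t] is one. *)
assert (E : t = x).
{ destruct (Req_dec t x) as [|Hne]; [assumption|exfalso].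
  assert (Hpos : 0 < Rabs (t - x) / 2)
    by (apply Rmult_lt_0_compat; [apply Rabs_pos_lt; lra | lra]).
  pose proof (Hx (ball x (mkposreal _ Hpos)) (locally_ball x (mkposreal _ Hpos))) as H.
  apply locally_singleton in H; specialize (H Ht).
  change (Rabs (t - x) < Rabs (t - x) / 2) in H; lra. }
subst x.
intros eps; apply (filter_le_within (F := locally t)).
exact (Hd t (fun P HP => HP) eps).
Qed.

Lemma is_derive_on_interior (T : R) (f : R -> R) (t l : R) :
  0 < t < T -> is_derive_on T f t l -> is_derive f t l.
Proof.
intros Ht [Hlin Hd]; split; [exact Hlin|].
intros x Hx.
assert (E : t = x)
  by exact (is_filter_lim_locally_unique (K := R_AbsRing) (V := R_NormedModule) t x Hx).
subst x; clear Hx.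
intros eps.
assert (Hw : is_filter_lim (within (fun s => 0 <= s <= T) (locally t)) t)
  by (intros P HP; exact (filter_le_within _ P HP)).
specialize (Hd t Hw eps); unfold within in Hd.
assert (HD : locally t (fun s => 0 <= s <= T)).
{ apply (filter_imp (fun s => 0 < s /\ s < T)); [intros s Hs; lra|].
  apply filter_and; [apply (open_gt 0) | apply (open_lt T)]; lra. }
generalize (filter_and _ _ HD Hd); apply filter_imp; intros s [H1 H2]; exact (H2 H1).
Qed.

(* Extends the restriction of [f] to [[0, T]] by constants, so that two-sided
   notions apply at the endpoints. *)
Definition clamp (T : R) (f : R -> R) (s : R) : R := f (Rmax 0 (Rmin s T)).

Lemma clamp_id (T : R) (f : R -> R) (s : R) : 0 <= s <= T -> clamp T f s = f s.
Proof.
intros Hs; unfold clamp; rewrite Rmin_left, Rmax_right by lra; reflexivity.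
Qed.

Lemma clamp_continuity (T : R) (f df : R -> R) : 0 <= T ->
  (forall t, 0 <= t <= T -> is_derive_on T f t (df t)) -> continuity (clamp T f).
Proof.
intros HT Hf x.
set (c := fun s => Rmax 0 (Rmin s T)).
assert (Hc : forall s, 0 <= c s <= T).
{ intros s; unfold c; split; [apply Rmax_l | apply Rmax_lub; [assumption | apply Rmin_r]]. }
assert (Hlip : forall s, Rabs (c s - c x) <= Rabs (s - x)).
{ intros s; unfold c, Rmax, Rmin.
  repeat destruct Rle_dec; unfold Rabs; repeat destruct Rcase_abs; lra. }
destruct (Hf (c x) (Hc x)) as [_ Hd].
assert (Hw : is_filter_lim (within (fun s => 0 <= s <= T) (locally (c x))) (c x))
  by (intros P HP; exact (filter_le_within _ P HP)).
(* Tolerance 1 makes [f] Lipschitz at this point with constant [1 + |df|], endpoints included. *)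
destruct (Hd (c x) Hw (mkposreal 1 Rlt_0_1)) as [r Hr].
set (M := 1 + Rabs (df (c x))).
assert (HM : 0 < M) by (unfold M; pose proof (Rabs_pos (df (c x))); lra).
apply continuity_pt_locally; intros eps.
assert (Hrho : 0 < Rmin r (eps / M)).
{ apply Rmin_glb_lt; [apply cond_pos | apply Rdiv_lt_0_compat; [apply cond_pos | assumption]]. }
exists (mkposreal _ Hrho); intros y Hy.
change (Rabs (y - x) < Rmin r (eps / M)) in Hy.
pose proof (Rlt_le_trans _ _ _ Hy (Rmin_l _ _)) as Hy1.
pose proof (Rlt_le_trans _ _ _ Hy (Rmin_r _ _)) as Hy2.
specialize (Hr (c y)); change (ball (c x) r (c y)) with (Rabs (c y - c x) < r) in Hr.
specialize (Hr ltac:(eapply Rle_lt_trans; [apply Hlip | exact Hy1]) (Hc y)).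
change (Rabs (f (c y) - f (c x) - (c y - c x) * df (c x)) <= 1 * Rabs (c y - c x)) in Hr.
change (Rabs (f (c y) - f (c x)) < eps).
apply Rle_lt_trans with (M * Rabs (c y - c x)).
- replace (f (c y) - f (c x)) with
    (f (c y) - f (c x) - (c y - c x) * df (c x) + (c y - c x) * df (c x)) by ring.
  eapply Rle_trans; [apply Rabs_triang|].
  rewrite Rabs_mult; unfold M; lra.
- apply Rle_lt_trans with (M * Rabs (y - x)).
  + apply Rmult_le_compat_l; [lra | apply Hlip].
  + apply Rlt_div_r in Hy2; [lra | assumption].
Qed.

Lemma clamp_derive (T : R) (f : R -> R) (t l : R) :
  0 < t < T -> is_derive_on T f t l -> is_derive (clamp T f) t l.
Proof.
intros Ht Hf; apply (is_derive_ext_loc f); [|apply is_derive_on_interior with T; assumption].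
apply (filter_imp (fun s => 0 < s /\ s < T)).
- intros s Hs; symmetry; apply clamp_id; lra.
- apply filter_and; [apply (open_gt 0) | apply (open_lt T)]; lra.
Qed.

Lemma gronwall_zero (T C : R) (E dE : R -> R) :
  continuity E -> (forall t, 0 < t < T -> is_derive E t (dE t)) ->
  (forall t, 0 < t < T -> dE t <= C * E t) -> E 0 = 0 ->
  forall t, 0 <= t <= T -> E t <= 0.
Proof.
intros HE HdE Hle HE0 t Ht.
set (g := fun s => E s * exp (- C * s)).
(* [MVT_gen] locates its point in the closed interval, where the sign of the
   derivative is unknown at the ends; the minimum makes it hold everywhere. *)
destruct (MVT_gen g 0 t (fun s => Rmin 0 ((dE s - C * E s) * exp (- C * s))))
  as [s [_ Hg]].
- rewrite Rmin_left, Rmax_right by lra; intros s Hs; unfold g.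
  pose proof (exp_pos (- C * s)) as Hexp.
  rewrite Rmin_right by (specialize (Hle s ltac:(lra)); nra).
  replace ((dE s - C * E s) * exp (- C * s)) with
    (dE s * exp (- C * s) + E s * (- C * exp (- C * s))) by ring.
  apply (is_derive_mult E (fun s => exp (- C * s))).
  + apply HdE; lra.
  + auto_derive; [trivial | ring].
  + intros; apply Rmult_comm.
- intros s _; apply continuity_pt_mult; [apply HE|].
  apply is_derive_continuity_pt with (- C * exp (- C * s)).
  auto_derive; [trivial | ring].
- set (d := Rmin _ _) in Hg.
  assert (Hd : d <= 0) by apply Rmin_l.
  unfold g in Hg; rewrite HE0, Rmult_0_l in Hg.
  pose proof (exp_pos (- C * t)); nra.
Qed.

(** Two given solutions are bounded on [[0, T]] by continuity, so the cubic force is Lipschitz along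
    them. Gronwall applies to the squared distance in phase space; its constant may be large, since
    the initial distance is zero. *)
Lemma solves_ivp_unique (omega c d eps T x0 y0 : R) (x w : R -> R) :
  solves_ivp omega c d eps T x0 y0 x -> solves_ivp omega c d eps T x0 y0 w ->
  forall t, 0 <= t <= T -> w t = x t.
Proof.
intros [x' [Hx0 [Hx'0 Hx]]] [w' [Hw0 [Hw'0 Hw]]] t Ht.
assert (HT : 0 <= T) by lra.
set (k := d / eps) in *.
set (F := fun u => omega ^ 2 * u + c * u ^ 2 + k * u ^ 3).
assert (Hx'' : forall s, 0 <= s <= T -> is_derive_on T x' s (- F (x s))).
{ intros s Hs; destruct (Hx s Hs) as [_ [z [Hz E]]].
  replace (- F (x s)) with z by (unfold F; lra); exact Hz. }
assert (Hw'' : forall s, 0 <= s <= T -> is_derive_on T w' s (- F (w s))).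
{ intros s Hs; destruct (Hw s Hs) as [_ [z [Hz E]]].
  replace (- F (w s)) with z by (unfold F; lra); exact Hz. }
assert (Hx' : forall s, 0 <= s <= T -> is_derive_on T x s (x' s))
  by (intros s Hs; apply Hx; exact Hs).
assert (Hw' : forall s, 0 <= s <= T -> is_derive_on T w s (w' s))
  by (intros s Hs; apply Hw; exact Hs).
clear Hx Hw.
pose proof (clamp_continuity T x x' HT Hx') as Cx.
pose proof (clamp_continuity T w w' HT Hw') as Cw.
pose proof (clamp_continuity T x' _ HT Hx'') as Cx'.
pose proof (clamp_continuity T w' _ HT Hw'') as Cw'.
assert (Hbound : forall f, continuity (clamp T f) ->
  exists B, forall s, 0 <= s <= T -> Rabs (f s) <= B).
{ intros f Cf.
  destruct (continuity_ab_maj (fun s => Rabs (clamp T f s)) 0 T HT) as [s0 [Hs0 _]].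
  - intros s _; apply (continuity_pt_comp (clamp T f) Rabs); [apply Cf | apply Rcontinuity_abs].
  - exists (Rabs (clamp T f s0)); intros s Hs.
    rewrite <- (clamp_id T f s Hs); apply Hs0; exact Hs. }
destruct (Hbound x Cx) as [Bx HBx]; destruct (Hbound w Cw) as [Bw HBw].
set (L := omega ^ 2 + Rabs c * (Bw + Bx) + Rabs k * (Bw ^ 2 + Bw * Bx + Bx ^ 2)).
assert (HF : forall s, 0 <= s <= T ->
  Rabs (F (w s) - F (x s)) <= L * Rabs (w s - x s)).
{ intros s Hs.
  specialize (HBx s Hs); specialize (HBw s Hs).
  pose proof (Rabs_pos (x s)); pose proof (Rabs_pos (w s)).
  replace (F (w s) - F (x s)) with
    ((omega ^ 2 + c * (w s + x s) + k * (w s ^ 2 + w s * x s + x s ^ 2)) * (w s - x s))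
    by (unfold F; ring).
  rewrite Rabs_mult; apply Rmult_le_compat_r; [apply Rabs_pos|].
  unfold L; eapply Rle_trans; [apply Rabs_triang|]; apply Rplus_le_compat.
  - eapply Rle_trans; [apply Rabs_triang|]; apply Rplus_le_compat.
    + rewrite Rabs_pos_eq by apply pow2_ge_0; lra.
    + rewrite Rabs_mult; apply Rmult_le_compat_l; [apply Rabs_pos|].
      eapply Rle_trans; [apply Rabs_triang | lra].
  - rewrite Rabs_mult; apply Rmult_le_compat_l; [apply Rabs_pos|].
    eapply Rle_trans; [apply Rabs_triang|]; apply Rplus_le_compat.
    + eapply Rle_trans; [apply Rabs_triang|]; apply Rplus_le_compat.
      * rewrite <- RPow_abs; apply pow_incr; lra.
      * rewrite Rabs_mult; apply Rmult_le_compat; assumption.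
    + rewrite <- RPow_abs; apply pow_incr; lra. }
set (a := fun s => clamp T w s - clamp T x s).
set (b := fun s => clamp T w' s - clamp T x' s).
assert (HE : a t ^ 2 + b t ^ 2 <= 0).
{ apply (gronwall_zero T (1 + L) (fun s => a s ^ 2 + b s ^ 2)
    (fun s => 2 * a s * b s - 2 * b s * (F (w s) - F (x s)))); [ | | | |exact Ht].
  - intros s; unfold a, b; reg; auto.
  - intros s Hs.
    assert (Ha : is_derive a s (w' s - x' s)).
    { apply (is_derive_minus (clamp T w) (clamp T x)); apply clamp_derive;
        auto; [apply Hw' | apply Hx']; lra. }
    assert (Hb : is_derive b s (- F (w s) - - F (x s))).
    { apply (is_derive_minus (clamp T w') (clamp T x')); apply clamp_derive;
        auto; [apply Hw'' | apply Hx'']; lra. }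
    replace (w' s - x' s) with (b s) in Ha by (unfold b; rewrite !clamp_id; lra).
    auto_derive.
    + split; [exists (b s); exact Ha | split; [exists (- F (w s) - - F (x s)); exact Hb | trivial]].
    + replace (Derive (fun r => a r) s) with (b s) by (symmetry; exact (is_derive_unique _ _ _ Ha)).
      replace (Derive (fun r => b r) s) with (- F (w s) - - F (x s))
        by (symmetry; exact (is_derive_unique _ _ _ Hb)).
      ring.
  - intros s Hs; specialize (HF s ltac:(lra)).
    replace (w s - x s) with (a s) in HF by (unfold a; rewrite !clamp_id; lra).
    set (D := F (w s) - F (x s)) in *.
    assert (HL : 0 <= L).
    { specialize (HBx s ltac:(lra)); specialize (HBw s ltac:(lra)).
      pose proof (Rabs_pos (x s)); pose proof (Rabs_pos (w s)).
      assert (0 <= Rabs c * (Bw + Bx)) by (apply Rmult_le_pos; [apply Rabs_pos | lra]).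
      assert (0 <= Rabs k * (Bw ^ 2 + Bw * Bx + Bx ^ 2))
        by (apply Rmult_le_pos; [apply Rabs_pos | nra]).
      pose proof (pow2_ge_0 omega); unfold L; lra. }
    pose proof (Rle_abs (- (b s * D))) as H1; rewrite Rabs_Ropp, Rabs_mult in H1.
    pose proof (Rabs_pos (a s)); pose proof (Rabs_pos (b s)).
    assert (Rabs (b s) * Rabs D <= Rabs (b s) * (L * Rabs (a s)))
      by (apply Rmult_le_compat_l; assumption).
    rewrite <- (pow2_abs (a s)), <- (pow2_abs (b s)).
    assert (0 <= L * (Rabs (a s) - Rabs (b s)) ^ 2)
      by (apply Rmult_le_pos; [assumption | apply pow2_ge_0]).
    assert (0 <= L * (Rabs (a s) ^ 2 + Rabs (b s) ^ 2)) by (apply Rmult_le_pos; nra).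
    pose proof (pow2_ge_0 (a s - b s)).
    pose proof (pow2_abs (a s)); pose proof (pow2_abs (b s)).
    nra.
  - unfold a, b; rewrite !clamp_id by lra; rewrite Hx0, Hw0, Hx'0, Hw'0; ring. }
assert (Ha : a t = 0) by nra.
unfold a in Ha; rewrite !clamp_id in Ha by exact Ht; lra.
Qed.

(** * Uniform orders of magnitude *)

(* [f e x = O(e ^ k)] as [e -> 0], uniformly in the second variable. *)
Definition order (delta : R) (k : nat) (f : R -> R -> R) : Prop :=
  exists K, forall e x, 0 < e < delta -> Rabs (f e x) <= K * e ^ k.

Lemma order_ext (delta : R) (k : nat) (f g : R -> R -> R) :
  order delta k f -> (forall e x, 0 < e < delta -> g e x = f e x) -> order delta k g.
Proof. intros [K HK] H; exists K; intros e x He; rewrite H; auto. Qed.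

Lemma order_const (delta k : R) : order delta 0 (fun _ _ => k).
Proof. exists (Rabs k); intros; simpl; lra. Qed.

Lemma order_eps (delta : R) : order delta 1 (fun e _ => e).
Proof. exists 1; intros e _ He; rewrite Rabs_pos_eq; simpl; lra. Qed.

Lemma order_nonneg (delta : R) (k : nat) (f : R -> R -> R) : order delta k f ->
  exists K, 0 <= K /\ forall e x, 0 < e < delta -> Rabs (f e x) <= K * e ^ k.
Proof.
intros [K HK]; exists (Rabs K); split; [apply Rabs_pos|]; intros e x He.
eapply Rle_trans; [apply HK; assumption|].
apply Rmult_le_compat_r; [apply pow_le; lra | apply Rle_abs].
Qed.

Lemma order_weaken (delta : R) (j k : nat) (f : R -> R -> R) :
  delta <= 1 -> (k <= j)%nat -> order delta j f -> order delta k f.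
Proof.
intros Hd Hkj Hf; destruct (order_nonneg _ _ _ Hf) as [K [HK0 HK]].
exists K; intros e x He; eapply Rle_trans; [apply HK; assumption|].
apply Rmult_le_compat_l; [assumption|].
replace j with (k + (j - k))%nat by lia; rewrite pow_add.
rewrite <- (Rmult_1_r (e ^ k)) at 2; apply Rmult_le_compat_l; [apply pow_le; lra|].
rewrite <- (pow1 (j - k)); apply pow_incr; lra.
Qed.

Lemma order_plus (delta : R) (j k : nat) (f g : R -> R -> R) : delta <= 1 ->
  order delta j f -> order delta k g ->
  order delta (Nat.min j k) (fun e x => f e x + g e x).
Proof.
intros Hd Hf Hg.
destruct (order_weaken _ _ (Nat.min j k) _ Hd (Nat.le_min_l j k) Hf) as [K HK].
destruct (order_weaken _ _ (Nat.min j k) _ Hd (Nat.le_min_r j k) Hg) as [L HL].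
exists (K + L); intros e x He; eapply Rle_trans; [apply Rabs_triang|].
specialize (HK e x He); specialize (HL e x He); lra.
Qed.

Lemma order_opp (delta : R) (k : nat) (f : R -> R -> R) :
  order delta k f -> order delta k (fun e x => - f e x).
Proof. intros [K HK]; exists K; intros; rewrite Rabs_Ropp; auto. Qed.

Lemma order_minus (delta : R) (j k : nat) (f g : R -> R -> R) : delta <= 1 ->
  order delta j f -> order delta k g ->
  order delta (Nat.min j k) (fun e x => f e x - g e x).
Proof.
intros Hd Hf Hg; apply (order_plus _ _ _ f (fun e x => - g e x)); auto using order_opp.
Qed.

Lemma order_mult (delta : R) (j k : nat) (f g : R -> R -> R) :
  order delta j f -> order delta k g ->
  order delta (j + k) (fun e x => f e x * g e x).
Proof.
intros [K HK] [L HL]; exists (K * L); intros e x He.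
rewrite Rabs_mult, pow_add.
replace (K * L * (e ^ j * e ^ k)) with ((K * e ^ j) * (L * e ^ k)) by ring.
apply Rmult_le_compat; auto using Rabs_pos.
Qed.

Lemma order_pow (delta : R) (k n : nat) (f : R -> R -> R) :
  order delta k f -> order delta (n * k) (fun e x => f e x ^ n).
Proof.
intros Hf; induction n as [|n IHn].
- apply (order_const delta 1).
- apply (order_mult delta k (n * k) f (fun e x => f e x ^ n)); assumption.
Qed.

Lemma order_le (delta : R) (k : nat) (f g : R -> R -> R) : order delta k g ->
  (forall e x, 0 < e < delta -> Rabs (f e x) <= Rabs (g e x)) -> order delta k f.
Proof.
intros [K HK] H; exists K; intros e x He.
eapply Rle_trans; [apply H | apply HK]; assumption.
Qed.

Lemma order_cos (delta : R) (f : R -> R -> R) : order delta 0 (fun e x => cos (f e x)).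
Proof. exists 1; intros; simpl; rewrite Rmult_1_r; apply Rabs_cos_le_1. Qed.

Lemma order_sin (delta : R) (f : R -> R -> R) : order delta 0 (fun e x => sin (f e x)).
Proof. exists 1; intros; simpl; rewrite Rmult_1_r; apply Rabs_sin_le_1. Qed.

Lemma order_subst (delta : R) (k : nat) (f y : R -> R -> R) :
  order delta k f -> order delta k (fun e x => f e (y e x)).
Proof. intros [K HK]; exists K; auto. Qed.

(* Proof of [order delta k f] for the best [k] that the hypotheses and the
   structure of [f] give; [Hd] proves [delta <= 1]. *)
Ltac order_proof delta Hd f :=
  match goal with
  (* Hypotheses are tried before the structure: a difference such as [A e - a] is small only as a
     whole. *)
  | H : order delta ?n ?g |- _ =>
      let _ := constr:(eq_refl : g = f) in constr:(H : order delta n f)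
  | _ =>
      lazymatch f with
      | (fun _ _ => ?k) => constr:(order_const delta k)
      | (fun e x => e) => constr:(order_eps delta)
      | (fun e x => cos (@?g e x)) => constr:(order_cos delta g)
      | (fun e x => sin (@?g e x)) => constr:(order_sin delta g)
      | (fun e x => @?g e x + @?h e x) =>
          let p := order_proof delta Hd g in let q := order_proof delta Hd h in
          constr:(order_plus delta _ _ g h Hd p q)
      | (fun e x => @?g e x - @?h e x) =>
          let p := order_proof delta Hd g in let q := order_proof delta Hd h in
          constr:(order_minus delta _ _ g h Hd p q)
      | (fun e x => @?g e x * @?h e x) =>
          let p := order_proof delta Hd g in let q := order_proof delta Hd h in
          constr:(order_mult delta _ _ g h p q)
      | (fun e x => @?g e x / @?h e x) =>
          let p := order_proof delta Hd g in
          let i := eval cbv beta in (fun e x => / h e x) in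
          let q := order_proof delta Hd i in
          constr:(order_mult delta _ _ g i p q)
      | (fun e x => - @?g e x) =>
          let p := order_proof delta Hd g in constr:(order_opp delta _ g p)
      | (fun e x => @?g e x ^ ?n) =>
          let p := order_proof delta Hd g in constr:(order_pow delta _ n g p)
      end
  end.

Ltac order_auto :=
  match goal with
  | Hd : ?delta <= 1 |- order ?delta ?k ?f =>
      let p := order_proof delta Hd f in
      let H := fresh in
      pose proof p as H; cbn [Nat.min Nat.add Nat.mul] in H;
      refine (order_weaken delta _ k f Hd _ H); lia
  end.

(** Here [g] regroups the function into blocks of known order; what remains is an algebraic
    identity. *)
Ltac order_by g :=
  apply (order_ext _ _ g); [order_auto | intros].

(** * Expansion of the exact orbit *)

(** Multiplying [P r - 1] by its conjugate removes the root: [P^2 (1 + z) - 1] is a polynomial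
    divisible by [z^3]. The factor 2 bounds [/ r]. *)
Lemma inv_sqrt_taylor2 (z : R) : Rabs z <= / 2 ->
  Rabs (/ sqrt (1 + z) - (1 - z / 2 + 3 * z ^ 2 / 8)) <= 2 * Rabs z ^ 3.
Proof.
intros Hz; pose proof (proj1 (Rabs_le_between _ _) Hz) as Hz'.
set (r := sqrt (1 + z)); set (P := 1 - z / 2 + 3 * z ^ 2 / 8).
assert (Hr2 : r * r = 1 + z) by (apply sqrt_sqrt; lra).
assert (Hr : / 2 <= r).
{ rewrite <- (sqrt_pow2 (/ 2)) by lra; apply sqrt_le_1; lra. }
assert (HP : 0 < P) by (unfold P; nra).
assert (Hkey : (P * r - 1) * (P * r + 1) = z ^ 3 * (5 / 8 - 15 / 64 * z + 9 / 64 * z ^ 2)).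
{ transitivity (P ^ 2 * (r * r) - 1); [ring|].
  rewrite Hr2; unfold P; field. }
assert (Hsmall : Rabs (P * r - 1) <= Rabs z ^ 3).
{ apply Rle_trans with (Rabs ((P * r - 1) * (P * r + 1))).
  - rewrite Rabs_mult; rewrite <- (Rmult_1_r (Rabs (P * r - 1))) at 1.
    apply Rmult_le_compat_l; [apply Rabs_pos|].
    rewrite Rabs_pos_eq; nra.
  - rewrite Hkey, Rabs_mult, <- RPow_abs.
    rewrite <- (Rmult_1_r (Rabs z ^ 3)) at 2.
    apply Rmult_le_compat_l; [apply pow_le, Rabs_pos|].
    apply Rabs_le; nra. }
replace (/ r - P) with (- (P * r - 1) * / r) by (field; lra).
rewrite Rabs_mult, Rabs_Ropp, Rabs_inv, (Rabs_pos_eq r) by lra.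
rewrite Rmult_comm; apply Rmult_le_compat.
- left; apply Rinv_0_lt_compat; lra.
- apply Rabs_pos.
- rewrite <- (Rinv_inv 2); apply Rinv_le_contravar; lra.
- exact Hsmall.
Qed.

Lemma order_primitive (delta : R) (k : nat) (f f' : R -> R -> R) (y : R) :
  (forall e x, 0 < e < delta -> is_derive (f e) x (f' e x)) ->
  (forall e, 0 < e < delta -> f e 0 = 0) -> order delta k f' ->
  order delta k (fun e _ => f e y).
Proof.
intros Hf Hf0 [K HK]; exists (K * Rabs y); intros e _ He.
pose proof (is_derive_bound (f e) (f' e) (K * e ^ k)
  (fun x => Hf e x He) (fun x => HK e x He) 0 y) as H.
rewrite (Hf0 e He), !Rminus_0_r in H.
eapply Rle_trans; [exact H | right; ring].
Qed.

(** Periodicity replaces the length of the integration interval by [per], so the bound is uniform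
    over all phases. *)
Lemma order_periodic_primitive (delta per : R) (k : nat) (f f' : R -> R -> R) :
  0 < per -> (forall e x, 0 < e < delta -> f e (x + per) = f e x) ->
  (forall e x, 0 < e < delta -> is_derive (f e) x (f' e x)) ->
  (forall e, 0 < e < delta -> f e 0 = 0) -> order delta k f' -> order delta k f.
Proof.
intros Hper Hshift Hf Hf0 Hf'; destruct (order_nonneg _ _ _ Hf') as [K [HK0 HK]].
exists (K * per); intros e x He.
apply (periodic_bound (f e) per); [assumption | intros; apply Hshift; assumption |].
intros y Hy.
pose proof (is_derive_bound (f e) (f' e) (K * e ^ k)
  (fun x => Hf e x He) (fun x => HK e x He) 0 y) as H.
rewrite (Hf0 e He), !Rminus_0_r, (Rabs_pos_eq y) in H by lra.
eapply Rle_trans; [exact H|].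
replace (K * per * e ^ k) with (K * e ^ k * per) by ring.
apply Rmult_le_compat_l; [|lra].
apply Rmult_le_pos; [assumption | apply pow_le; lra].
Qed.

Section Expansion.

Variables (w c d a delta L : R) (u0 v0 m A phi0 nu : R -> R) (T phi : R -> R -> R).
Hypothesis Hw : 0 < w.
Hypothesis Hdelta : delta <= 1.
Hypothesis Hdata : forall e, 0 < e < delta ->
  orbit_data w (e * c) (e * d) L (u0 e) (v0 e) (m e) (A e) (phi0 e).

Let S (e x : R) : R := speed2 (w ^ 2) (e * c) (e * d) (m e) (A e) (A e * cos x).

Hypothesis HT0 : forall e, 0 < e < delta -> T e 0 = 0.
Hypothesis HT : forall e x, 0 < e < delta -> is_derive (T e) x (/ sqrt (S e x)).
Hypothesis Hnu : forall e, 0 < e < delta -> nu e * T e (2 * PI) = 2 * PI.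
Hypothesis Hphi : forall e t, 0 < e < delta -> T e (phi e t) = t + T e (phi0 e).
Hypothesis Hu0 : order delta 2 (fun e _ =>
  u0 e - (a + e * (- (c * a ^ 2) / (3 * w ^ 2) + d * a ^ 3 / (32 * w ^ 2)))).
Hypothesis Hv0 : order delta 2 (fun e _ => v0 e).

Lemma amplitude_bounded : order delta 0 (fun e _ => A e).
Proof.
exists (2 * L); intros e _ He; rewrite Rmult_1_r.
apply (Hdata e He).
Qed.

Lemma centre_small : order delta 1 (fun e _ => m e).
Proof.
exists (Rabs c * L ^ 2 / w ^ 2); intros e _ He.
destruct (Hdata e He) as [_ [Hm _]].
rewrite Rabs_mult, (Rabs_pos_eq e) in Hm by lra.
replace (Rabs c * L ^ 2 / w ^ 2 * e ^ 1) with (e * Rabs c * L ^ 2 / w ^ 2)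
  by (field; lra).
exact Hm.
Qed.

(** The balance is solved for [m]; every term beyond the leading one carries a factor [e * m], which
    is already [O(e^2)]. *)
Lemma centre_expansion :
  order delta 2 (fun e _ => m e + e * (c * A e ^ 2 / (3 * w ^ 2))).
Proof.
pose proof amplitude_bounded; pose proof centre_small.
order_by (fun e (_ : R) =>
  - (e * c * m e ^ 2 + e * d * m e ^ 3 + e * d * m e * A e ^ 2) / w ^ 2).
destruct (Hdata e H1) as [Hb _]; unfold balanced in Hb.
apply Rmult_eq_reg_l with (w ^ 2); [|apply pow_nonzero; lra].
transitivity (w ^ 2 * m e + e * c / 3 * A e ^ 2); [field; lra|].
transitivity (- (e * c * m e ^ 2 + e * d * m e ^ 3 + e * d * m e * A e ^ 2));
  [lra | field; lra].
Qed.

Lemma amplitude_defect : order delta 2 (fun e _ => m e + A e - u0 e).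
Proof.
apply (order_le _ _ _ (fun e _ => 2 / w * v0 e)).
- pose proof Hv0; order_auto.
- intros e _ He; destruct (Hdata e He) as [_ [_ [_ [H _]]]].
  rewrite Rabs_mult, (Rabs_pos_eq (2 / w)).
  + replace (2 / w * Rabs (v0 e)) with (2 * Rabs (v0 e) / w) by (field; lra); exact H.
  + left; apply Rdiv_lt_0_compat; lra.
Qed.

Lemma amplitude_expansion1 : order delta 1 (fun e _ => A e - a).
Proof.
pose proof amplitude_defect; pose proof centre_small; pose proof Hu0.
order_by (fun e (_ : R) => (m e + A e - u0 e) - m e
  + (u0 e - (a + e * (- (c * a ^ 2) / (3 * w ^ 2) + d * a ^ 3 / (32 * w ^ 2))))
  + e * (- (c * a ^ 2) / (3 * w ^ 2) + d * a ^ 3 / (32 * w ^ 2))).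
ring.
Qed.

(** The centre accounts for the [c] term of the initial position, leaving only the [d] term in the
    amplitude. *)
Lemma amplitude_expansion2 :
  order delta 2 (fun e _ => A e - (a + e * (d * a ^ 3 / (32 * w ^ 2)))).
Proof.
pose proof amplitude_defect; pose proof centre_expansion; pose proof Hu0.
pose proof amplitude_bounded; pose proof amplitude_expansion1.
order_by (fun e (_ : R) => (m e + A e - u0 e)
  + (u0 e - (a + e * (- (c * a ^ 2) / (3 * w ^ 2) + d * a ^ 3 / (32 * w ^ 2))))
  - (m e + e * (c * A e ^ 2 / (3 * w ^ 2)))
  + e * c / (3 * w ^ 2) * ((A e - a) * (A e + a))).
field; lra.
Qed.

Lemma speed2_expansion : order delta 3 (fun e x => S e x -
  (w ^ 2 + e * (2 * c / 3 * A e * cos x + d / 2 * A e ^ 2 * (1 + cos x ^ 2))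
   - e ^ 2 * (2 * c ^ 2 * A e ^ 2 / (3 * w ^ 2)
              + 2 * c * d * A e ^ 3 / (3 * w ^ 2) * cos x))).
Proof.
pose proof amplitude_bounded; pose proof centre_small; pose proof centre_expansion.
order_by (fun e x =>
  2 * e * (c + d * A e * cos x) * (m e + e * (c * A e ^ 2 / (3 * w ^ 2)))
  + 3 * e * d * m e ^ 2).
unfold S, speed2; field; lra.
Qed.

Lemma inv_speed_expansion : order delta 3 (fun e x => w * / sqrt (S e x) -
  (1 + e * (- (2 * c / 3 * A e * cos x + d / 2 * A e ^ 2 * (1 + cos x ^ 2)) / (2 * w ^ 2))
   + e ^ 2 * ((c ^ 2 * A e ^ 2 + c * d * A e ^ 3 * cos x) / (3 * w ^ 4)
     + 3 * (2 * c / 3 * A e * cos x + d / 2 * A e ^ 2 * (1 + cos x ^ 2)) ^ 2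
       / (8 * w ^ 4)))).
Proof.
pose proof amplitude_bounded; pose proof speed2_expansion as HS.
set (s1 := fun e x => 2 * c / 3 * A e * cos x + d / 2 * A e ^ 2 * (1 + cos x ^ 2)).
set (s2 := fun e x => 2 * c ^ 2 * A e ^ 2 / (3 * w ^ 2)
              + 2 * c * d * A e ^ 3 / (3 * w ^ 2) * cos x).
assert (Hs1 : order delta 0 s1) by (unfold s1; order_auto).
assert (Hs2 : order delta 0 s2) by (unfold s2; order_auto).
fold (s1 : R -> R -> R) in HS.
change (order delta 3 (fun e x => S e x - (w ^ 2 + e * s1 e x - e ^ 2 * s2 e x))) in HS.
set (z := fun e x => S e x / w ^ 2 - 1).
assert (Hz3 : order delta 3 (fun e x => z e x - (e * s1 e x - e ^ 2 * s2 e x) / w ^ 2)).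
{ order_by (fun e x => (S e x - (w ^ 2 + e * s1 e x - e ^ 2 * s2 e x)) / w ^ 2).
  unfold z; field; lra. }
assert (Hz2 : order delta 2 (fun e x => z e x - e * s1 e x / w ^ 2)).
{ order_by (fun e x => (z e x - (e * s1 e x - e ^ 2 * s2 e x) / w ^ 2)
    - e ^ 2 * s2 e x / w ^ 2).
  field; lra. }
assert (Hz1 : order delta 1 z).
{ order_by (fun e x => (z e x - e * s1 e x / w ^ 2) + e * s1 e x / w ^ 2).
  ring. }
assert (Hinv : order delta 3 (fun e x =>
  w * / sqrt (S e x) - (1 - z e x / 2 + 3 * z e x ^ 2 / 8))).
{ apply (order_le _ _ _ (fun e x => 2 * z e x ^ 3)); [order_auto|].
  intros e x He.
  destruct (Hdata e He) as [_ [_ [_ [_ [HSb _]]]]].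
  specialize (HSb (cos x) (Rabs_cos_le_1 x)); fold (S e x) in HSb.
  assert (Ho : 0 < w ^ 2) by (apply pow_lt; assumption).
  assert (Ez : S e x - w ^ 2 = w ^ 2 * z e x) by (unfold z; field; lra).
  assert (Hzb : Rabs (z e x) <= / 2).
  { rewrite Ez, Rabs_mult, (Rabs_pos_eq (w ^ 2)) in HSb by lra.
    apply Rmult_le_reg_l with (w ^ 2); [assumption | lra]. }
  replace (w * / sqrt (S e x)) with (/ sqrt (1 + z e x)).
  { rewrite Rabs_mult, (Rabs_pos_eq 2), <- RPow_abs by lra.
    apply inv_sqrt_taylor2; assumption. }
  replace (S e x) with (w ^ 2 * (1 + z e x)) by lra.
  apply Rabs_le_between in Hzb.
  rewrite sqrt_mult, sqrt_pow2 by lra.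
  pose proof (sqrt_lt_R0 (1 + z e x) ltac:(lra)); field; lra. }
order_by (fun e x => (w * / sqrt (S e x) - (1 - z e x / 2 + 3 * z e x ^ 2 / 8))
  - (z e x - (e * s1 e x - e ^ 2 * s2 e x) / w ^ 2) / 2
  + 3 / 8 * ((z e x - e * s1 e x / w ^ 2) * (z e x + e * s1 e x / w ^ 2))).
unfold s1, s2; generalize (/ sqrt (S e x)); intros; field; lra.
Qed.

Lemma inv_speed_bounds (e x : R) : 0 < e < delta -> / (2 * w) <= / sqrt (S e x) <= 2 / w.
Proof.
intros He; destruct (Hdata e He) as [_ [_ [_ [_ [HS _]]]]].
specialize (HS (cos x) (Rabs_cos_le_1 x)); fold (S e x) in HS.
apply Rabs_le_between in HS.
assert (Ho : 0 < w ^ 2) by (apply pow_lt; assumption).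
assert (Hlow : w / 2 <= sqrt (S e x)).
{ rewrite <- (sqrt_pow2 (w / 2)) by lra; apply sqrt_le_1; nra. }
assert (Hup : sqrt (S e x) <= 2 * w).
{ rewrite <- (sqrt_pow2 (2 * w)) by lra; apply sqrt_le_1; nra. }
split.
- apply Rinv_le_contravar; lra.
- replace (2 / w) with (/ (w / 2)) by (field; lra); apply Rinv_le_contravar; lra.
Qed.

Lemma period_expansion : order delta 3 (fun e _ => w * T e (2 * PI) / (2 * PI) -
  (1 - e * (3 * d * A e ^ 2 / (8 * w ^ 2))
   + e ^ 2 * (5 * c ^ 2 * A e ^ 2 / (12 * w ^ 4) + 57 * d ^ 2 * A e ^ 4 / (256 * w ^ 4)))).
Proof.
pose proof PI_RGT_0 as HPI.
(* antiderivatives of the first two coefficients of [inv_speed_expansion] *)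
set (G1 := fun e x => - (2 * c / 3 * A e * sin x
  + d / 2 * A e ^ 2 * (3 / 2 * x + sin x * cos x / 2)) / (2 * w ^ 2)).
set (G2 := fun e x => (c ^ 2 * A e ^ 2 * x + c * d * A e ^ 3 * sin x) / (3 * w ^ 4)
  + 3 / (8 * w ^ 4) * (4 * c ^ 2 / 9 * A e ^ 2 * (x / 2 + sin x * cos x / 2)
    + 2 * c * d / 3 * A e ^ 3 * (2 * sin x - sin x ^ 3 / 3)
    + d ^ 2 / 4 * A e ^ 4 * (19 / 8 * x + 11 / 8 * (sin x * cos x)
        + sin x * cos x ^ 3 / 4))).
assert (H : order delta 3 (fun e _ =>
  w * T e (2 * PI) - (2 * PI + e * G1 e (2 * PI) + e ^ 2 * G2 e (2 * PI)))).
{ refine (order_primitive delta 3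
    (fun e x => w * T e x - (x + e * G1 e x + e ^ 2 * G2 e x)) _ (2 * PI) _ _
    inv_speed_expansion).
  - intros e x He.
    apply (is_derive_minus (fun x => w * T e x) (fun x => x + e * G1 e x + e ^ 2 * G2 e x)).
    + apply is_derive_scal, HT; exact He.
    + assert (Hsc : sin x ^ 2 = 1 - cos x ^ 2)
        by (pose proof (sin2_cos2 x) as E; unfold Rsqr in E; lra).
      unfold G1, G2; auto_derive; [trivial | field [Hsc]; lra].
  - intros e He; unfold G1, G2; rewrite (HT0 e He), sin_0; field; lra. }
order_by (fun e (_ : R) =>
  (w * T e (2 * PI) - (2 * PI + e * G1 e (2 * PI) + e ^ 2 * G2 e (2 * PI))) / (2 * PI)).
(* At [2 PI] only the linear parts survive, that is, the means: 3/2 for [1 + cos^2] and 19/8 for its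
   square, whence 57/256 = 3/8 * 1/4 * 19/8. *)
unfold G1, G2; rewrite sin_2PI; field; lra.
Qed.

Lemma frequency_pos (e : R) : 0 < e < delta -> 0 < nu e <= 2 * w.
Proof.
intros He; pose proof PI_RGT_0 as HPI.
assert (HP : / (2 * w) * (2 * PI - 0) <= T e (2 * PI) - T e 0).
{ apply is_derive_increase with (fun x => / sqrt (S e x)).
  - intros z; apply HT; exact He.
  - intros z; apply (inv_speed_bounds e z He).
  - lra. }
rewrite (HT0 e He), !Rminus_0_r in HP.
replace (/ (2 * w) * (2 * PI)) with (PI / w) in HP by (field; lra).
assert (HP0 : 0 < PI / w) by (apply Rdiv_lt_0_compat; lra).
pose proof (Hnu e He) as E.
assert (Hpos : 0 < nu e) by nra.
split; [exact Hpos|].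
apply Rmult_le_reg_r with (PI / w); [exact HP0|].
replace (2 * w * (PI / w)) with (2 * PI) by (field; lra).
rewrite <- E; apply Rmult_le_compat_l; lra.
Qed.

Lemma frequency_bounded : order delta 0 (fun e _ => nu e).
Proof.
exists (2 * w); intros e _ He; rewrite Rmult_1_r.
pose proof (frequency_pos e He); rewrite Rabs_pos_eq; lra.
Qed.

Lemma frequency_expansion_amplitude : order delta 3 (fun e _ => nu e -
  (w + e * (3 * d * A e ^ 2 / (8 * w))
   - e ^ 2 * (5 * c ^ 2 * A e ^ 2 / (12 * w ^ 3) + 21 * d ^ 2 * A e ^ 4 / (256 * w ^ 3)))).
Proof.
pose proof amplitude_bounded; pose proof frequency_bounded; pose proof period_expansion.
pose proof PI_RGT_0 as HPI.
set (n1 := fun e => - (3 * d * A e ^ 2 / (8 * w ^ 2))).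
set (n2 := fun e => 5 * c ^ 2 * A e ^ 2 / (12 * w ^ 4) + 57 * d ^ 2 * A e ^ 4 / (256 * w ^ 4)).
assert (Hn1 : order delta 0 (fun e _ => n1 e)) by (unfold n1; order_auto).
assert (Hn2 : order delta 0 (fun e _ => n2 e)) by (unfold n2; order_auto).
set (D := fun e => w * T e (2 * PI) / (2 * PI)).
assert (HD : order delta 3 (fun e _ => D e - (1 + e * n1 e + e ^ 2 * n2 e))).
{ apply (order_ext _ _ _ _ H1); intros; unfold D, n1, n2; ring. }
(* From [nu D = w], with [1 - e n1 + e^2 (n1^2 - n2)] as truncated inverse of [D]. The [d^2]
   coefficient is 36/256 - 57/256. *)
order_by (fun e (_ : R) => nu e *
  (- (D e - (1 + e * n1 e + e ^ 2 * n2 e)) * (1 - e * n1 e + e ^ 2 * (n1 e ^ 2 - n2 e))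
   - e ^ 3 * (n1 e * (n1 e ^ 2 - n2 e) - n1 e * n2 e)
   - e ^ 4 * (n2 e * (n1 e ^ 2 - n2 e)))).
assert (E : nu e * D e = w).
{ unfold D; replace (nu e * (w * T e (2 * PI) / (2 * PI))) with
    (nu e * T e (2 * PI) * w / (2 * PI)) by (field; lra).
  rewrite Hnu by assumption; field; lra. }
transitivity (nu e - w * (1 - e * n1 e + e ^ 2 * (n1 e ^ 2 - n2 e))).
- unfold n1, n2; field; lra.
- rewrite <- E; ring.
Qed.

(** The first-order part of [A], fed into the term [3 d A^2 / (8 w)], adds 6/256 to the coefficient
    -21/256 of [d^2 a^4 / w^3]. *)
Lemma frequency_expansion : order delta 3 (fun e _ => nu e -
  (w + e * (3 * d * a ^ 2 / (8 * w))
   + e ^ 2 * (- (5 * c ^ 2 * a ^ 2) / (12 * w ^ 3) - 15 * d ^ 2 * a ^ 4 / (256 * w ^ 3)))).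
Proof.
pose proof amplitude_bounded; pose proof amplitude_expansion1.
pose proof amplitude_expansion2; pose proof frequency_expansion_amplitude.
order_by (fun e (_ : R) =>
  (nu e - (w + e * (3 * d * A e ^ 2 / (8 * w))
   - e ^ 2 * (5 * c ^ 2 * A e ^ 2 / (12 * w ^ 3) + 21 * d ^ 2 * A e ^ 4 / (256 * w ^ 3))))
  + 3 * d / (8 * w) * e * ((A e - a) ^ 2
      + 2 * a * (A e - (a + e * (d * a ^ 3 / (32 * w ^ 2)))))
  - e ^ 2 * ((A e - a) * (5 * c ^ 2 * (A e + a) / (12 * w ^ 3)
      + 21 * d ^ 2 * ((A e + a) * (A e ^ 2 + a ^ 2)) / (256 * w ^ 3)))).
field; lra.
Qed.

(* The angle [nu T(x)], linear in time, exceeds [x] by [e q(x)] up to [O(e^2)]. *)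
Let q (e x : R) : R :=
  - (2 * c / 3 * A e * sin x + d / 4 * A e ^ 2 * (sin x * cos x)) / (2 * w ^ 2).

(** The frequency correction [k1] is minus the mean of [g1], so [k1 + g1] has the periodic primitive
    [q]. *)
Lemma phase_expansion : order delta 2 (fun e x => nu e * T e x - x - e * q e x).
Proof.
pose proof amplitude_bounded; pose proof frequency_expansion_amplitude as Hn.
pose proof inv_speed_expansion as Hi; pose proof PI_RGT_0 as HPI.
set (k1 := fun e => 3 * d * A e ^ 2 / (8 * w ^ 2)).
set (g1 := fun e x => - (2 * c / 3 * A e * cos x + d / 2 * A e ^ 2 * (1 + cos x ^ 2))
  / (2 * w ^ 2)).
assert (Hk1 : order delta 0 (fun e _ => k1 e)) by (unfold k1; order_auto).
assert (Hg1 : order delta 0 g1) by (unfold g1; order_auto).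
assert (Hn2 : order delta 2 (fun e _ => nu e / w - (1 + e * k1 e))).
{ order_by (fun e (_ : R) => (nu e - (w + e * (3 * d * A e ^ 2 / (8 * w))
    - e ^ 2 * (5 * c ^ 2 * A e ^ 2 / (12 * w ^ 3) + 21 * d ^ 2 * A e ^ 4 / (256 * w ^ 3)))) / w
    - e ^ 2 * (5 * c ^ 2 * A e ^ 2 / (12 * w ^ 3) + 21 * d ^ 2 * A e ^ 4 / (256 * w ^ 3)) / w).
  unfold k1; field; lra. }
assert (Hi2 : order delta 2 (fun e x => w * / sqrt (S e x) - (1 + e * g1 e x))).
{ match type of Hi with order _ _ (fun e x => _ - (_ + e ^ 2 * @?g2 e x)) =>
    order_by (fun e x => (w * / sqrt (S e x) - (1 + e * g1 e x + e ^ 2 * g2 e x))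
      + e ^ 2 * g2 e x) end.
  ring. }
assert (Hnu0 := frequency_bounded).
refine (order_periodic_primitive delta (2 * PI) 2
  (fun e x => nu e * T e x - x - e * q e x)
  (fun e x => nu e / w * (w * / sqrt (S e x) - (1 + e * g1 e x))
    + (nu e / w - (1 + e * k1 e)) * (1 + e * g1 e x) + e ^ 2 * k1 e * g1 e x) _ _ _ _ _).
- lra.
- intros e x He.
  rewrite (primitive_shift (T e) (fun y => / sqrt (S e y)) (2 * PI)).
  + pose proof (Hnu e He) as E; unfold q; rewrite sin_plus, cos_plus, sin_2PI, cos_2PI.
    rewrite Rmult_plus_distr_l, E; field; lra.
  + intros y; apply HT; exact He.
  + intros y; unfold S; rewrite cos_plus, cos_2PI, sin_2PI, !Rmult_0_r, Rmult_1_r, Rminus_0_r.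
    reflexivity.
  + apply HT0; exact He.
- intros e x He.
  assert (Hsc : sin x ^ 2 = 1 - cos x ^ 2)
    by (pose proof (sin2_cos2 x) as E; unfold Rsqr in E; lra).
  replace (nu e / w * _ + _ + _) with (nu e * / sqrt (S e x)
    - (1 + e * (- (2 * c / 3 * A e * cos x + d / 4 * A e ^ 2 * (2 * cos x ^ 2 - 1))
       / (2 * w ^ 2)))).
  2: { unfold k1, g1; generalize (/ sqrt (S e x)); intros; field; lra. }
  apply (is_derive_ext (fun x => nu e * T e x - (x + e * q e x)));
    [intros y; apply Rminus_diag_uniq; ring|].
  apply (is_derive_minus (fun x => nu e * T e x) (fun x => x + e * q e x)).
  + apply is_derive_scal, HT; exact He.
  + unfold q; auto_derive; [trivial | field [Hsc]; lra].
- intros e He; unfold q; rewrite (HT0 e He), sin_0; field; lra.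
- order_auto.
Qed.

Let lag (e : R) : R := nu e * T e (phi0 e).

Lemma lag_le (e : R) : 0 < e < delta -> Rabs (lag e) <= 4 * Rabs (phi0 e).
Proof.
intros He; destruct (frequency_pos e He) as [Hn1 Hn2].
pose proof (is_derive_bound (T e) (fun x => / sqrt (S e x)) (2 / w)) as H.
specialize (H (fun x => HT e x He)).
assert (HK : forall x, Rabs (/ sqrt (S e x)) <= 2 / w).
{ intros x; destruct (inv_speed_bounds e x He) as [H1 H2].
  rewrite Rabs_pos_eq; [assumption|].
  apply Rle_trans with (2 := H1); left; apply Rinv_0_lt_compat; lra. }
specialize (H HK 0 (phi0 e)); rewrite (HT0 e He), !Rminus_0_r in H.
unfold lag; rewrite Rabs_mult, (Rabs_pos_eq (nu e)) by lra.
replace (4 * Rabs (phi0 e)) with (2 * w * (2 / w * Rabs (phi0 e))) by (field; lra).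
apply Rmult_le_compat; [lra | apply Rabs_pos | assumption | assumption].
Qed.

Lemma lag_bounded : order delta 0 (fun e _ => lag e).
Proof.
exists (4 * PI); intros e _ He; rewrite Rmult_1_r.
apply Rle_trans with (1 := lag_le e He).
destruct (Hdata e He) as [_ [_ [_ [_ [_ [_ [_ [H _]]]]]]]]; lra.
Qed.

Lemma amplitude_lag : order delta 2 (fun e _ => A e * lag e).
Proof.
apply (order_le _ _ _ (fun e _ => 48 / w * v0 e)).
- pose proof Hv0; order_auto.
- intros e _ He; destruct (Hdata e He) as [_ [_ [_ [_ [_ [_ [_ [_ H]]]]]]]].
  rewrite Rabs_mult in H |- *.
  apply Rle_trans with (Rabs (A e) * (4 * Rabs (phi0 e))).
  + apply Rmult_le_compat_l; [apply Rabs_pos | apply lag_le; exact He].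
  + rewrite Rabs_mult, (Rabs_pos_eq (48 / w)) by (left; apply Rdiv_lt_0_compat; lra).
    replace (48 / w * Rabs (v0 e)) with (4 * (12 * Rabs (v0 e) / w)) by (field; lra).
    lra.
Qed.

(** The phase is [nu t + g] with [g = lag - y], and [y] is [e q] to first order. The product
    [q * sin (nu t)] creates the second and third harmonics; it also yields a multiple of
    [cos (nu t)], which the first-order part of [A] cancels. This explains the [d] term of the
    initial position. *)
Lemma orbit_expansion : order delta 2 (fun e t => m e + A e * cos (phi e t) -
  (a * cos (nu e * t) + e * (- (c * a ^ 2) / (2 * w ^ 2)
     + c * a ^ 2 / (6 * w ^ 2) * cos (2 * nu e * t)
     + d * a ^ 3 / (32 * w ^ 2) * cos (3 * nu e * t)))).
Proof.
pose proof amplitude_bounded as HA; pose proof amplitude_expansion1 as HA1.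
pose proof amplitude_expansion2 as HA2; pose proof centre_expansion as Hm.
pose proof lag_bounded as Hlag; pose proof amplitude_lag as HAlag.
set (y := fun e t => nu e * T e (phi e t) - phi e t).
set (h := fun e t => y e t - e * q e (phi e t)).
assert (Hh : order delta 2 h) by exact (order_subst _ _ _ phi phase_expansion).
assert (Hq : order delta 0 (fun e t => q e (phi e t))) by (unfold q; order_auto).
assert (Hy : order delta 1 y).
{ order_by (fun e t => h e t + e * q e (phi e t)).
  unfold h; ring. }
set (g := fun e t => phi e t - nu e * t).
assert (Hg : forall e t, 0 < e < delta -> g e t = lag e - y e t).
{ intros e t He; unfold g, lag, y; rewrite Hphi by exact He; ring. }
assert (HAg : order delta 1 (fun e t => A e * g e t)).
{ order_by (fun e t => A e * lag e - A e * y e t).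
  rewrite Hg by assumption; ring. }
(* The lag itself is merely bounded; one factor [A * lag] of order 2 is enough. *)
assert (HAg2 : order delta 2 (fun e t => A e * g e t ^ 2)).
{ order_by (fun e t => A e * lag e * lag e - 2 * (A e * lag e) * y e t + A e * y e t ^ 2).
  rewrite Hg by assumption; ring. }
assert (Hcos : order delta 2 (fun e t =>
  A e * (cos (phi e t) - cos (nu e * t) + g e t * sin (nu e * t)))).
{ apply (order_le _ _ _ _ HAg2); intros e t He.
  rewrite !Rabs_mult; apply Rmult_le_compat_l; [apply Rabs_pos|].
  replace (phi e t) with (nu e * t + g e t) by (unfold g; ring).
  eapply Rle_trans; [apply cos_taylor1 | apply Rle_abs]. }
assert (HAs : order delta 1 (fun e t => A e * (sin (phi e t) - sin (nu e * t)))).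
{ apply (order_le _ _ _ _ HAg); intros e t He.
  rewrite !Rabs_mult; apply Rmult_le_compat_l; [apply Rabs_pos | apply sin_lipschitz]. }
assert (HAc : order delta 1 (fun e t => A e * (cos (phi e t) - cos (nu e * t)))).
{ apply (order_le _ _ _ _ HAg); intros e t He.
  rewrite !Rabs_mult; apply Rmult_le_compat_l; [apply Rabs_pos | apply cos_lipschitz]. }
order_by (fun e t =>
  (m e + e * (c * A e ^ 2 / (3 * w ^ 2)))
  + (A e - (a + e * (d * a ^ 3 / (32 * w ^ 2)))) * cos (nu e * t)
  + A e * (cos (phi e t) - cos (nu e * t) + g e t * sin (nu e * t))
  - (A e * lag e - A e * h e t) * sin (nu e * t)
  - e * sin (nu e * t) / (2 * w ^ 2) *
     (2 * c / 3 * A e * (A e * (sin (phi e t) - sin (nu e * t)))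
      + d / 4 * A e ^ 2 * (A e * (sin (phi e t) - sin (nu e * t)) * cos (phi e t)
           + sin (nu e * t) * (A e * (cos (phi e t) - cos (nu e * t)))))
  - e * c / (3 * w ^ 2) * ((A e - a) * (A e + a))
  - e * sin (nu e * t) / (2 * w ^ 2) *
     (2 * c / 3 * ((A e - a) * (A e + a)) * sin (nu e * t)
      + d / 4 * ((A e - a) * (A e ^ 2 + A e * a + a ^ 2))
          * (sin (nu e * t) * cos (nu e * t)))).
rename x into t.
replace (3 * nu e * t) with (2 * (nu e * t) + nu e * t) by ring.
replace (2 * nu e * t) with (2 * (nu e * t)) by ring.
rewrite cos_plus, sin_2a, cos_2a_cos.
assert (Hsc : sin (nu e * t) ^ 2 = 1 - cos (nu e * t) ^ 2)
  by (pose proof (sin2_cos2 (nu e * t)) as E; unfold Rsqr in E; lra).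
unfold h; replace (y e t) with (lag e - g e t) by (rewrite Hg by assumption; ring).
unfold q; generalize (sin (phi e t)) (cos (phi e t)) (lag e) (g e t); intros.
field [Hsc]; lra.
Qed.

End Expansion.

(** * Derivatives of the remainder *)

(** The relation [2 w k1 a = 3/4 d a^3] cancels the [cos (nu t)] part of the cube. The second and
    third harmonics are those of [u] weighted by 4 and 9, as two derivatives require. *)
Lemma acceleration_expansion (w c d a delta : R) (nu : R -> R) (u : R -> R -> R) :
  0 < w -> delta <= 1 ->
  order delta 3 (fun e _ => nu e - (w + e * (3 * d * a ^ 2 / (8 * w))
   + e ^ 2 * (- (5 * c ^ 2 * a ^ 2) / (12 * w ^ 3) - 15 * d ^ 2 * a ^ 4 / (256 * w ^ 3)))) ->
  order delta 2 (fun e t => u e t -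
    (a * cos (nu e * t) + e * (- (c * a ^ 2) / (2 * w ^ 2)
       + c * a ^ 2 / (6 * w ^ 2) * cos (2 * nu e * t)
       + d * a ^ 3 / (32 * w ^ 2) * cos (3 * nu e * t)))) ->
  order delta 2 (fun e t =>
    - (w ^ 2 * u e t + e * c * u e t ^ 2 + e * d * u e t ^ 3) -
    - nu e ^ 2 * (a * cos (nu e * t) + e * (2 * c * a ^ 2 / (3 * w ^ 2) * cos (2 * nu e * t)
       + 9 * d * a ^ 3 / (32 * w ^ 2) * cos (3 * nu e * t)))).
Proof.
intros Hw Hdelta Hnu Hu.
set (C := fun e t => cos (nu e * t)).
set (U1 := fun e t => - (c * a ^ 2) / (2 * w ^ 2)
       + c * a ^ 2 / (6 * w ^ 2) * cos (2 * nu e * t)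
       + d * a ^ 3 / (32 * w ^ 2) * cos (3 * nu e * t)).
set (W1 := fun e t => 2 * c * a ^ 2 / (3 * w ^ 2) * cos (2 * nu e * t)
       + 9 * d * a ^ 3 / (32 * w ^ 2) * cos (3 * nu e * t)).
assert (HC : order delta 0 C) by (unfold C; order_auto).
assert (HU1 : order delta 0 U1) by (unfold U1; order_auto).
assert (HW1 : order delta 0 W1) by (unfold W1; order_auto).
set (k1 := 3 * d * a ^ 2 / (8 * w)).
assert (Hnu2 : order delta 2 (fun e _ => nu e - (w + e * k1))).
{ match type of Hnu with order _ _ (fun e _ => _ - (_ + e ^ 2 * ?k2)) =>
    order_by (fun e (_ : R) => (nu e - (w + e * k1 + e ^ 2 * k2)) + e ^ 2 * k2) end.
  ring. }
assert (Hnu0 : order delta 0 (fun e _ => nu e)).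
{ order_by (fun e (_ : R) => (nu e - (w + e * k1)) + (w + e * k1)).
  ring. }
change (order delta 2 (fun e t => u e t - (a * C e t + e * U1 e t))) in Hu.
set (rho := fun e t => u e t - (a * C e t + e * U1 e t)).
assert (Hrho : order delta 2 rho) by exact Hu.
order_by (fun e t =>
  - w ^ 2 * rho e t
  - e * c * ((rho e t + e * U1 e t) * (2 * a * C e t + rho e t + e * U1 e t))
  - e * d * ((rho e t + e * U1 e t) * ((a * C e t + rho e t + e * U1 e t) ^ 2
       + (a * C e t + rho e t + e * U1 e t) * (a * C e t) + (a * C e t) ^ 2))
  + (nu e - (w + e * k1)) * (nu e + (w + e * k1)) * (a * C e t + e * W1 e t)
  + e ^ 2 * (2 * w * k1 * W1 e t + k1 ^ 2 * (a * C e t + e * W1 e t))).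
rename x into t.
replace (u e t) with (rho e t + (a * C e t + e * U1 e t)) by (unfold rho; ring).
generalize (rho e t); intros s.
change (cos (nu e * t)) with (C e t).
unfold U1, W1.
replace (3 * nu e * t) with (2 * (nu e * t) + nu e * t) by ring.
replace (2 * nu e * t) with (2 * (nu e * t)) by ring.
rewrite cos_plus, sin_2a, cos_2a_cos; fold (C e t).
assert (Hsc : sin (nu e * t) ^ 2 = 1 - C e t ^ 2)
  by (pose proof (sin2_cos2 (nu e * t)) as E; unfold Rsqr in E; unfold C; lra).
unfold k1; field [Hsc]; lra.
Qed.

(** On [[t, t + 1]] the derivative equals [r (t + 1) - r t] somewhere, and it varies by at most
    [K2]. *)
Lemma derive_bound_interpolation (r r1 r2 : R -> R) (K0 K2 : R) :
  (forall t, is_derive r t (r1 t)) -> (forall t, is_derive r1 t (r2 t)) ->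
  (forall t, Rabs (r t) <= K0) -> (forall t, Rabs (r2 t) <= K2) ->
  forall t, Rabs (r1 t) <= 2 * K0 + K2.
Proof.
intros H1 H2 B0 B2 t.
destruct (MVT_gen r t (t + 1) r1) as [s [Hs E]].
- intros z _; apply H1.
- intros z _; apply is_derive_continuity_pt with (r1 z), H1.
- rewrite Rmin_left, Rmax_right in Hs by lra.
  pose proof (is_derive_bound r1 r2 K2 H2 B2 s t) as Hlip.
  assert (HK2 : 0 <= K2) by (pose proof (B2 t); pose proof (Rabs_pos (r2 t)); lra).
  assert (Hst : Rabs (t - s) <= 1) by (apply Rabs_le; lra).
  assert (K2 * Rabs (t - s) <= K2 * 1) by (apply Rmult_le_compat_l; assumption).
  replace (r1 t) with (r (t + 1) + - r t + (r1 t - r1 s)) by lra.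
  eapply Rle_trans; [apply Rabs_triang|].
  pose proof (Rabs_triang (r (t + 1)) (- r t)) as Ht; rewrite Rabs_Ropp in Ht.
  pose proof (B0 t); pose proof (B0 (t + 1)); lra.
Qed.

Lemma C2_bounded_intro (M T : R) (r r1 r2 : R -> R) :
  (forall t, is_derive r t (r1 t)) -> (forall t, is_derive r1 t (r2 t)) ->
  (forall t, continuous r2 t) ->
  (forall t, Rabs (r t) <= M) -> (forall t, Rabs (r1 t) <= M) ->
  (forall t, Rabs (r2 t) <= M) -> C2_bounded M T r.
Proof.
intros H1 H2 C2 B0 B1 B2 k Hk t _.
assert (E1 : forall s, r1 s = Derive_n r 1 s)
  by (intros s; symmetry; exact (is_derive_unique _ _ _ (H1 s))).
assert (E2 : forall s, r2 s = Derive_n r 2 s).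
{ intros s; symmetry; change (Derive (Derive_n r 1) s = r2 s).
  rewrite <- (Derive_ext r1 (Derive_n r 1) s E1); exact (is_derive_unique _ _ _ (H2 s)). }
destruct k as [|[|[|k]]]; [ | | |lia].
- split; [exact I | split; [|apply B0]].
  apply (ex_derive_continuous r); exists (r1 t); apply H1.
- split; [exists (r1 t); apply H1 | split; [|rewrite <- E1; apply B1]].
  apply (continuous_ext r1 _ t E1).
  apply (ex_derive_continuous r1); exists (r2 t); apply H2.
- split; [|split; [|rewrite <- E2; apply B2]].
  + exists (r2 t); apply (is_derive_ext r1 _ t _ E1), H2.
  + apply (continuous_ext r2 _ t E2), C2.
Qed.

(** * Motion along an exact orbit *)

Lemma orbit_motion (w p q L u0 v0 m A phi0 : R) :
  0 < w -> orbit_data w p q L u0 v0 m A phi0 ->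
  let S x := speed2 (w ^ 2) p q m A (A * cos x) in
  exists (nu : R) (T phi : R -> R), T 0 = 0 /\
    (forall x, is_derive T x (/ sqrt (S x))) /\ nu * T (2 * PI) = 2 * PI /\
    (forall t, T (phi t) = t + T phi0) /\ phi 0 = phi0 /\
    (forall t, is_derive phi t (sqrt (S (phi t)))).
Proof.
intros Hw [_ [_ [_ [_ [HS _]]]]] S.
assert (Ho : 0 < w ^ 2) by (apply pow_lt; assumption).
assert (HSb : forall x, w ^ 2 / 2 <= S x <= 4 * w ^ 2).
{ intros x; specialize (HS (cos x) (Rabs_cos_le_1 x)).
  apply Rabs_le_between in HS; unfold S; lra. }
assert (Hk : forall x, / (2 * w) <= / sqrt (S x)).
{ intros x; specialize (HSb x).
  apply Rinv_le_contravar; [apply sqrt_lt_R0; lra|].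
  rewrite <- (sqrt_pow2 (2 * w)) by lra; apply sqrt_le_1; nra. }
assert (Hk0 : 0 < / (2 * w)) by (apply Rinv_0_lt_compat; lra).
destruct (primitive_exists (fun x => / sqrt (S x))) as [T [HT0 HT]].
{ intros x; apply (ex_derive_continuous (fun x => / sqrt (S x))).
  specialize (HSb x); pose proof (sqrt_lt_R0 (S x) ltac:(lra)).
  assert (ex_derive S x) by (unfold S, speed2; auto_derive; trivial).
  auto_derive; repeat split; [assumption | lra | lra]. }
destruct (increasing_inverse T _ _ Hk0 Hk HT) as [psi [Hpsi1 [Hpsi2 Hpsi3]]].
assert (HP : 0 < T (2 * PI)).
{ pose proof PI_RGT_0.
  pose proof (is_derive_increase T _ _ 0 (2 * PI) HT Hk ltac:(lra)) as H1.
  assert (0 < / (2 * w) * (2 * PI - 0)) by (apply Rmult_lt_0_compat; lra).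
  lra. }
exists (2 * PI / T (2 * PI)), T, (fun t => psi (t + T phi0)).
split; [exact HT0 | split; [exact HT | split; [field; lra | split; [intros; apply Hpsi1|]]]].
split; [rewrite Rplus_0_l; apply Hpsi2|].
intros t.
replace (sqrt (S (psi (t + T phi0)))) with (1 * / / sqrt (S (psi (t + T phi0))))
  by (rewrite Rinv_inv; ring).
apply (is_derive_comp psi (fun t => t + T phi0)); [apply Hpsi3|].
auto_derive; [trivial | ring].
Qed.

(** The explicit velocity is differentiated, rather than the energy identity, so nothing is divided
    by [u']: turning points and [A = 0] need no separate treatment. *)
Lemma orbit_ode (o p q m A : R) (phi : R -> R) :
  let S x := speed2 o p q m A (A * cos x) in
  let u t := m + A * cos (phi t) in
  balanced o p q m A -> (forall x, 0 < S x) ->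
  (forall t, is_derive phi t (sqrt (S (phi t)))) ->
  (forall t, is_derive u t (- A * sin (phi t) * sqrt (S (phi t)))) /\
  (forall t, is_derive (fun t => - A * sin (phi t) * sqrt (S (phi t))) t
    (- (o * u t + p * u t ^ 2 + q * u t ^ 3))).
Proof.
intros S u Hb HS Hphi.
assert (Hcomp : forall f df t, is_derive f (phi t) df ->
  is_derive (fun t => f (phi t)) t (sqrt (S (phi t)) * df))
  by (intros f df t Hf; exact (is_derive_comp f phi t _ _ Hf (Hphi t))).
split; intros t.
- replace (- A * sin (phi t) * sqrt (S (phi t)))
    with (sqrt (S (phi t)) * (- A * sin (phi t))) by ring.
  apply (Hcomp (fun x => m + A * cos x)).
  auto_derive; [trivial | ring].
- set (x := phi t).
  assert (HSd : is_derive S x ((2 * p / 3 + 2 * q * m + q * (A * cos x)) * (- A * sin x))).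
  { unfold S, speed2; auto_derive; [trivial | field]. }
  pose proof (sqrt_lt_R0 _ (HS x)) as Hr.
  pose proof (sqrt_sqrt _ (Rlt_le _ _ (HS x))) as Hr2.
  unfold u; rewrite (balanced_force o p q m A _ Hb); fold x; fold (S x).
  rewrite <- Hr2.
  replace (- (_ - _)) with (sqrt (S x) * (- A * cos x * sqrt (S x) + - A * sin x
    * ((2 * p / 3 + 2 * q * m + q * (A * cos x)) * (- A * sin x) / (2 * sqrt (S x))))).
  + apply (Hcomp (fun x => - A * sin x * sqrt (S x))).
    apply (is_derive_mult (fun x => - A * sin x) (fun x => sqrt (S x))).
    * auto_derive; [trivial | ring].
    * apply is_derive_sqrt; [exact HSd | apply HS].
    * intros; apply Rmult_comm.
  + assert (Hsc : sin x ^ 2 = 1 - cos x ^ 2)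
      by (pose proof (sin2_cos2 x) as E; unfold Rsqr in E; lra).
    field [Hsc]; lra.
Qed.

(** * Small parameters and conclusion *)

Lemma at_right_0_iff (P : R -> Prop) :
  at_right 0 P <-> exists delta, 0 < delta /\ forall e, 0 < e < delta -> P e.
Proof.
split.
- intros [r Hr]; exists r; split; [apply cond_pos|]; intros e He; apply Hr; [|lra].
  change (Rabs (e - 0) < r); rewrite Rminus_0_r, Rabs_pos_eq; lra.
- intros [delta [Hd HP]]; exists (mkposreal _ Hd); intros e He He0.
  change (Rabs (e - 0) < delta) in He; rewrite Rminus_0_r, Rabs_pos_eq in He by lra.
  apply HP; lra.
Qed.

Lemma bigO_0_elim (f : R -> R) (k : nat) : bigO_0 f (fun eps => eps ^ k) ->
  exists K delta, 0 <= K /\ 0 < delta /\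
    forall e, 0 < e < delta -> Rabs (f e) <= K * e ^ k.
Proof.
intros [K HK]; apply at_right_0_iff in HK; destruct HK as [delta [Hd HK]].
exists (Rabs K), delta; split; [apply Rabs_pos | split; [exact Hd|]].
intros e He; specialize (HK e He).
rewrite (Rabs_pos_eq (e ^ k)) in HK by (apply pow_le; lra).
eapply Rle_trans; [exact HK|].
apply Rmult_le_compat_r; [apply pow_le; lra | apply Rle_abs].
Qed.

(** Orbit data exist for each [e] separately, but expansions concern functions of [e]; [b0] fills in
    where nothing is required. *)
Lemma choice_below {B : Type} (b0 : B) (delta : R) (P : R -> B -> Prop) :
  (forall e, 0 < e < delta -> exists b, P e b) ->
  exists f : R -> B, forall e, 0 < e < delta -> P e (f e).
Proof.
intros H.
assert (H' : forall e, exists b, 0 < e < delta -> P e b).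
{ intros e; destruct (classic (0 < e < delta)) as [He | He].
  - destruct (H e He) as [b Hb]; exists b; auto.
  - exists b0; tauto. }
exists (fun e => proj1_sig (constructive_indefinite_description _ (H' e))).
intros e; exact (proj2_sig (constructive_indefinite_description _ (H' e))).
Qed.

Lemma order_div_eps (delta : R) (k : nat) (f : R -> R -> R) :
  order delta k f -> exists K, forall e t, 0 < e < delta -> Rabs (f e t / e ^ k) <= K.
Proof.
intros [K HK]; exists K; intros e t He.
assert (Hp : 0 < e ^ k) by (apply pow_lt; lra).
unfold Rdiv; rewrite Rabs_mult, Rabs_inv, (Rabs_pos_eq (e ^ k)) by lra.
apply Rmult_le_reg_r with (e ^ k); [exact Hp|].
rewrite Rmult_assoc, Rinv_l, Rmult_1_r by lra; apply HK; exact He.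
Qed.

Theorem proposition2p1 (omega c d a : R) (omega_gt0 : 0 < omega) :
  exists gamma : R, 0 < gamma /\
  forall x0 v0 : R -> R,
    (* initial data: x(0) = x0 eps, where x = eps u, and u'(0) = v0 eps *)
    bigO_0
      (fun eps => x0 eps -
        (eps * a + eps ^ 2 * (- (c * a ^ 2) / (3 * omega ^ 2)
                              + d * a ^ 3 / (32 * omega ^ 2))))
      (fun eps => eps ^ 3) ->
    bigO_0 v0 (fun eps => eps ^ 2) ->
  exists nu : R -> R,
    bigO_0
      (fun eps => nu eps -
        (omega + eps * (3 * d * a ^ 2 / (8 * omega))
         + eps ^ 2 * (- (5 * c ^ 2 * a ^ 2) / (12 * omega ^ 3)
                      - 15 * d ^ 2 * a ^ 4 / (256 * omega ^ 3))))
      (fun eps => eps ^ 3) /\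
  exists (x r : R -> R -> R) (M : R),
    at_right 0 (fun eps =>
      let T := gamma / eps ^ 2 in
      (* x eps is the solution on [0, T] *)
      solves_ivp omega c d eps T (x0 eps) (eps * v0 eps) (x eps) /\
      (forall w : R -> R,
        solves_ivp omega c d eps T (x0 eps) (eps * v0 eps) w ->
        forall t, 0 <= t <= T -> w t = x eps t) /\
      (forall t, 0 <= t <= T ->
        x eps t =
          eps * a * cos (nu eps * t)
          + eps ^ 2 * (- (c * a ^ 2) / (2 * omega ^ 2)
                       + c * a ^ 2 / (6 * omega ^ 2) * cos (2 * nu eps * t)
                       + d * a ^ 3 / (32 * omega ^ 2) * cos (3 * nu eps * t))
          + eps ^ 3 * r eps t) /\
      C2_bounded M T (r eps)).
Proof.
(* The expansion holds for all times, so the size of [gamma] is irrelevant. *)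
exists 1; split; [lra|].
intros x0 v0 Hx0 Hv0.
apply bigO_0_elim in Hx0; destruct Hx0 as [K0 [d0 [HK0 [Hd0 Hx0]]]].
apply bigO_0_elim in Hv0; destruct Hv0 as [K1 [d1 [HK1 [Hd1 Hv0]]]].
assert (Ho : 0 < omega ^ 2) by (apply pow_lt; assumption).
set (b := - (c * a ^ 2) / (3 * omega ^ 2) + d * a ^ 3 / (32 * omega ^ 2)) in *.
set (u0 := fun e => x0 e / e).
(* Bounds [|u0| + 2 |v0| / omega] for all small [e] at once. *)
set (L := Rabs a + Rabs b + K0 + 2 * K1 / omega).
assert (HL : 0 <= L).
{ pose proof (Rabs_pos a); pose proof (Rabs_pos b).
  assert (0 <= 2 * K1 / omega) by (apply Rdiv_le_0_compat; lra).
  unfold L; lra. }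
assert (Hsmall : forall s, 0 <= s -> exists ds, 0 < ds /\
  forall e, 0 < e < ds -> e * s <= omega ^ 2 / 16).
{ intros s Hs; exists (omega ^ 2 / (16 * (s + 1))); split.
  - apply Rdiv_lt_0_compat; lra.
  - intros e He; destruct He as [He1 He2].
    apply Rlt_div_r in He2; lra. }
destruct (Hsmall (Rabs c * L)) as [d2 [Hd2 Hc]].
{ apply Rmult_le_pos; [apply Rabs_pos | exact HL]. }
destruct (Hsmall (Rabs d * L ^ 2)) as [d3 [Hd3 Hd]].
{ apply Rmult_le_pos; [apply Rabs_pos | apply pow_le; exact HL]. }
set (delta := Rmin 1 (Rmin (Rmin d0 d1) (Rmin d2 d3))).
assert (Hdelta : 0 < delta /\ delta <= 1 /\ delta <= d0 /\ delta <= d1 /\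
  delta <= d2 /\ delta <= d3).
{ unfold delta; repeat split; [repeat apply Rmin_glb_lt; lra | | | | |];
    unfold Rmin; repeat destruct Rle_dec; lra. }
clearbody delta; destruct Hdelta as [Hdelta [Hdelta1 [Hdd0 [Hdd1 [Hdd2 Hdd3]]]]].
assert (Hu0e : forall e, 0 < e < delta -> Rabs (u0 e - (a + e * b)) <= K0 * e ^ 2).
{ intros e He; specialize (Hx0 e ltac:(lra)).
  replace (u0 e - (a + e * b)) with (/ e * (x0 e - (e * a + e ^ 2 * b)))
    by (unfold u0; field; lra).
  rewrite Rabs_mult, (Rabs_pos_eq (/ e)) by (left; apply Rinv_0_lt_compat; lra).
  apply Rmult_le_reg_l with e; [lra|].
  rewrite <- Rmult_assoc, Rinv_r, Rmult_1_l by lra.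
  eapply Rle_trans; [exact Hx0 | right; ring]. }
assert (Hu0 : order delta 2 (fun e _ => u0 e - (a + e * b)))
  by (exists K0; intros e _; apply Hu0e).
assert (Hv0' : order delta 2 (fun e _ => v0 e))
  by (exists K1; intros e _ He; apply Hv0; lra).
assert (Hdata : exists mA : R -> R * R * R, forall e, 0 < e < delta ->
  orbit_data omega (e * c) (e * d) L (u0 e) (v0 e)
    (fst (fst (mA e))) (snd (fst (mA e))) (snd (mA e))).
{ apply (choice_below (0, 0, 0) delta (fun e z =>
    orbit_data omega (e * c) (e * d) L (u0 e) (v0 e) (fst (fst z)) (snd (fst z)) (snd z))).
  intros e He.
  destruct (orbit_data_exists omega (e * c) (e * d) L (u0 e) (v0 e)) as [m [A [phi0 H]]].
  - exact omega_gt0.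
  - specialize (Hu0e e He); specialize (Hv0 e ltac:(lra)).
    assert (He2 : e ^ 2 <= 1) by nra.
    assert (K0 * e ^ 2 <= K0) by nra.
    assert (Rabs (v0 e) <= K1) by nra.
    assert (2 * Rabs (v0 e) / omega <= 2 * K1 / omega).
    { apply Rmult_le_compat_r; [left; apply Rinv_0_lt_compat; exact omega_gt0 | lra]. }
    assert (Rabs (e * b) <= Rabs b).
    { rewrite Rabs_mult, (Rabs_pos_eq e) by lra; pose proof (Rabs_pos b); nra. }
    pose proof (Rabs_triang (u0 e - (a + e * b)) (a + e * b)) as Ht1.
    pose proof (Rabs_triang a (e * b)) as Ht2.
    replace (u0 e - (a + e * b) + (a + e * b)) with (u0 e) in Ht1 by ring.
    unfold L; lra.
  - rewrite Rabs_mult, (Rabs_pos_eq e) by lra; specialize (Hc e ltac:(lra)); lra.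
  - rewrite Rabs_mult, (Rabs_pos_eq e) by lra; specialize (Hd e ltac:(lra)); lra.
  - exists (m, A, phi0); exact H. }
destruct Hdata as [mA Hdata].
set (m := fun e => fst (fst (mA e))) in *.
set (A := fun e => snd (fst (mA e))) in *.
set (phi0 := fun e => snd (mA e)) in *.
change (forall e, 0 < e < delta ->
  orbit_data omega (e * c) (e * d) L (u0 e) (v0 e) (m e) (A e) (phi0 e)) in Hdata.
clearbody m A phi0; clear mA.
set (S := fun e x => speed2 (omega ^ 2) (e * c) (e * d) (m e) (A e) (A e * cos x)).
set (motion := fun e (nu : R) (T phi : R -> R) =>
  T 0 = 0 /\ (forall x, is_derive T x (/ sqrt (S e x))) /\ nu * T (2 * PI) = 2 * PI /\
  (forall t, T (phi t) = t + T (phi0 e)) /\ phi 0 = phi0 e /\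
  (forall t, is_derive phi t (sqrt (S e (phi t))))).
assert (Hmotion : exists ntp : R -> R * (R -> R) * (R -> R), forall e, 0 < e < delta ->
  motion e (fst (fst (ntp e))) (snd (fst (ntp e))) (snd (ntp e))).
{ apply (choice_below (0, fun _ => 0, fun _ => 0) delta (fun e z =>
    motion e (fst (fst z)) (snd (fst z)) (snd z))).
  intros e He.
  destruct (orbit_motion _ _ _ _ _ _ _ _ _ omega_gt0 (Hdata e He)) as [nu [T [phi H]]].
  exists (nu, T, phi); exact H. }
destruct Hmotion as [ntp Hmotion].
set (nu := fun e => fst (fst (ntp e))).
set (T := fun e => snd (fst (ntp e))).
set (phi := fun e => snd (ntp e)).
change (forall e, 0 < e < delta -> motion e (nu e) (T e) (phi e)) in Hmotion.
clearbody nu T phi; clear ntp.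
assert (HT0 : forall e, 0 < e < delta -> T e 0 = 0) by (intros e He; apply (Hmotion e He)).
assert (HT : forall e x, 0 < e < delta -> is_derive (T e) x (/ sqrt (S e x)))
  by (intros e x He; apply (Hmotion e He)).
assert (HnuT : forall e, 0 < e < delta -> nu e * T e (2 * PI) = 2 * PI)
  by (intros e He; apply (Hmotion e He)).
assert (Hphi : forall e t, 0 < e < delta -> T e (phi e t) = t + T e (phi0 e))
  by (intros e t He; apply (Hmotion e He)).
assert (Hnu := frequency_expansion omega c d a delta L u0 v0 m A phi0 nu T
  omega_gt0 Hdelta1 Hdata HT0 HT HnuT Hu0 Hv0').
assert (HU := orbit_expansion omega c d a delta L u0 v0 m A phi0 nu T phi
  omega_gt0 Hdelta1 Hdata HT0 HT HnuT Hphi Hu0 Hv0').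
assert (HU2 := acceleration_expansion omega c d a delta nu
  (fun e t => m e + A e * cos (phi e t)) omega_gt0 Hdelta1 Hnu HU).
exists nu; split.
{ destruct (order_nonneg _ _ _ Hnu) as [K [HK HKe]]; exists K.
  apply at_right_0_iff; exists delta; split; [exact Hdelta|].
  intros e He; rewrite (Rabs_pos_eq (e ^ 3)) by (apply pow_le; lra).
  exact (HKe e 0 He). }
set (u := fun e t => m e + A e * cos (phi e t)) in *.
set (u' := fun e t => - A e * sin (phi e t) * sqrt (S e (phi e t))).
set (u'' := fun e t => - (omega ^ 2 * u e t + e * c * u e t ^ 2 + e * d * u e t ^ 3)).
set (U := fun e t => a * cos (nu e * t) + e * (- (c * a ^ 2) / (2 * omega ^ 2)
     + c * a ^ 2 / (6 * omega ^ 2) * cos (2 * nu e * t)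
     + d * a ^ 3 / (32 * omega ^ 2) * cos (3 * nu e * t))).
set (U' := fun e t => - nu e * (a * sin (nu e * t)
     + e * (c * a ^ 2 / (3 * omega ^ 2) * sin (2 * nu e * t)
     + 3 * d * a ^ 3 / (32 * omega ^ 2) * sin (3 * nu e * t)))).
set (U'' := fun e t => - nu e ^ 2 * (a * cos (nu e * t)
     + e * (2 * c * a ^ 2 / (3 * omega ^ 2) * cos (2 * nu e * t)
     + 9 * d * a ^ 3 / (32 * omega ^ 2) * cos (3 * nu e * t)))).
change (order delta 2 (fun e t => u e t - U e t)) in HU.
change (order delta 2 (fun e t => u'' e t - U'' e t)) in HU2.
destruct (order_div_eps _ _ _ HU) as [M0 HM0].
destruct (order_div_eps _ _ _ HU2) as [M2 HM2].
(* The remainder is [e (u - U) / e^3]. The constant is the interpolation bound for its first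
   derivative and dominates [M0] and [M2]. *)
exists (fun e t => e * u e t), (fun e t => (u e t - U e t) / e ^ 2), (2 * M0 + M2).
apply at_right_0_iff; exists delta; split; [exact Hdelta|].
intros e He Te.
assert (Hode : (forall t, is_derive (u e) t (u' e t)) /\
  (forall t, is_derive (u' e) t (u'' e t))).
{ destruct (Hdata e He) as [Hb [_ [_ [_ [HS _]]]]].
  apply (orbit_ode (omega ^ 2) (e * c) (e * d) (m e) (A e) (phi e)); [exact Hb | |].
  - intros x; specialize (HS (cos x) (Rabs_cos_le_1 x)).
    apply Rabs_le_between in HS; lra.
  - apply (Hmotion e He). }
destruct Hode as [Hu1 Hu2].
assert (Hsol : solves_ivp omega c d e Te (x0 e) (e * v0 e) (fun t => e * u e t)).
{ exists (fun t => e * u' e t).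
  destruct (Hdata e He) as [_ [_ [_ [_ [_ [E1 [E2 _]]]]]]].
  destruct (Hmotion e He) as [_ [_ [_ [_ [E3 _]]]]].
  split; [|split].
  - unfold u; rewrite E3, <- E1; unfold u0; field; lra.
  - unfold u', S; rewrite E3, <- E2; reflexivity.
  - intros t Ht; split.
    + apply is_derive_on_intro; [exact Ht | apply is_derive_scal, Hu1].
    + exists (e * u'' e t); split.
      * apply is_derive_on_intro; [exact Ht | apply is_derive_scal, Hu2].
      * unfold u''; field; lra. }
split; [exact Hsol|].
split; [intros y Hy; exact (solves_ivp_unique _ _ _ _ _ _ _ _ _ Hsol Hy)|].
split; [intros t _; unfold U; field; lra|].
assert (HU' : forall t, is_derive (U e) t (U' e t)).
{ intros t; unfold U, U'; auto_derive; [trivial | field; lra]. }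
assert (HU'' : forall t, is_derive (U' e) t (U'' e t)).
{ intros t; unfold U', U''; auto_derive; [trivial | field; lra]. }
assert (Hdiff : forall f g f' g' : R -> R,
  (forall t, is_derive f t (f' t)) -> (forall t, is_derive g t (g' t)) ->
  forall t, is_derive (fun t => (f t - g t) / e ^ 2) t ((f' t - g' t) / e ^ 2)).
{ intros f g f' g' Hf Hg t.
  apply (is_derive_ext (fun t => / e ^ 2 * (f t - g t))); [intros; apply Rmult_comm|].
  replace ((f' t - g' t) / e ^ 2) with (/ e ^ 2 * (f' t - g' t)) by apply Rmult_comm.
  apply is_derive_scal, (is_derive_minus f g); auto. }
pose proof (Hdiff _ _ _ _ Hu1 HU') as Hr1; pose proof (Hdiff _ _ _ _ Hu2 HU'') as Hr2.
assert (B0 : 0 <= M0) by (eapply Rle_trans; [apply Rabs_pos | exact (HM0 e 0 He)]).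
assert (B2 : 0 <= M2) by (eapply Rle_trans; [apply Rabs_pos | exact (HM2 e 0 He)]).
apply (C2_bounded_intro _ _ _ _ _ Hr1 Hr2).
- intros t; apply (ex_derive_continuous (fun t => (u'' e t - U'' e t) / e ^ 2)).
  assert (ex_derive (u e) t) by (exists (u' e t); apply Hu1).
  unfold u'', U''; auto_derive; tauto.
- intros t; specialize (HM0 e t He); lra.
- exact (derive_bound_interpolation _ _ _ M0 M2 Hr1 Hr2
    (fun t => HM0 e t He) (fun t => HM2 e t He)).
- intros t; specialize (HM2 e t He); lra.
Qed.
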